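(* Let $u_0\in \dot H^{2(1+2/p)}(\Omega)$, $u_0\neq0$, for some $p\in(1,\infty)$, let $g=\exp(\mathbb{L}T)u_0$, and for each sufficiently small $\delta>0$ let $g^\delta\in L^2(\Omega)$ satisfy $\|g-g^\delta\|_{L^2(\Omega)}\le\delta$. Let $s\ge1+\frac1p$ and let $\tilde g^\delta=w^{(i_* )}$ be the smoothed data obtained from $g^\delta$ by the Landweber iteration $w^{(i+1)}=w^{(i)}-\mu(-\mathbb{L})^{-2s}(w^{(i)}-g^\delta)$, $w^{(0)}=0$, stopped at an index $i_*=i_*(\delta)\in\mathbb{N}$ with $i_*\sim T^{-2}\log\bigl(\|u_0\|_{L^2(\Omega)}/\delta\bigr)$. For $\alpha\in(0,1)$ set $$u_0^\delta(\cdot;\alpha)=\sum_{k=1}^\infty\frac{1}{E_{\alpha,1}(-\lambda_kT^\alpha)}\,\langle\tilde g^\delta,\phi_k\rangle\,\phi_k .$$ Let $1<\underline\tau<\overline\tau$ be fixed constants independent of $\tilde\delta$, and assume that $\alpha=\alpha(\tilde g^\delta,\tilde\delta)\in(0,1)$ is chosen according to the discrepancy principle $$\underline\tau\,\tilde\delta\le\|\exp(\mathbb{L}T)u_0^\delta(\cdot;\alpha)-\tilde g^\delta\|_{L^2(\Omega)}\le\overline\tau\,\tilde\delta .$$ Then $$u_0^\delta\bigl(\cdot;\alpha(\tilde g^\delta,\tilde\delta)\bigr)\rightharpoonup u_0\quad\text{weakly in }L^2(\Omega)\quad\text{as }\delta\to0 .$$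
   Context: $\Omega$ is a bounded, simply connected domain in Euclidean space with $C^2$ boundary; $\mathbb{L}$ is a uniformly elliptic second order partial differential operator with sufficiently smooth coefficients and homogeneous Dirichlet boundary conditions, with domain $H^2(\Omega)\cap H_0^1(\Omega)$, such that $-\mathbb{L}$ is self-adjoint and positive in $L^2(\Omega)$. Its eigenvalues, counted with multiplicity, are $0<\lambda_1\le\lambda_2\le\dots$, with $L^2(\Omega)$-orthonormal eigenfunctions $\phi_k$; $\langle\cdot,\cdot\rangle$ is the $L^2(\Omega)$ inner product. $T>0$ is fixed. Operators are defined spectrally: $(-\mathbb{L})^\beta f=\sum_k\lambda_k^\beta\langle f,\phi_k\rangle\phi_k$ and $\exp(\mathbb{L}T)f=\sum_k e^{-\lambda_kT}\langle f,\phi_k\rangle\phi_k$. For $r\geq 0$, $\dot H^r(\Omega)=\{v\in L^2(\Omega):\|v\|_{\dot H^r}^2=\sum_k\lambda_k^r\langle v,\phi_k\rangle^2<\infty\}$. $E_{\alpha,1}(z)=\sum_{k=0}^\infty z^k/\Gamma(\alpha k+1)$ is the Mittag-Leffler function. The constant $\mu>0$ is fixed such that $\|\mu(-\mathbb{L})^{-2s}\|_{L^2\to L^2}\le1$. The notation $i_*\sim X(\delta)$ means $c\,X(\delta)\le i_*\le C\,X(\delta)$ for all small $\delta$ with constants $0<c\le C$ independent of $\delta$. The quantity $\tilde\delta$ is $\tilde\delta=C_2\,T^{-1}\,\delta\,\sqrt{\log(\|u_0\|_{L^2(\Omega)}/\delta)}$, where $C_2>0$ is a fixed constant independent of $T$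 and $\delta$. *)

(* Defs.v *)
From HB Require Import structures.
From mathcomp Require Import all_boot all_order all_algebra.
From mathcomp Require Import all_classical all_reals all_analysis.
Set Implicit Arguments.
Unset Strict Implicit.
Unset Printing Implicit Defensive.
Import Order.TTheory GRing.Theory Num.Theory.
Import numFieldNormedType.Exports.
Local Open Scope classical_set_scope.
Local Open Scope ring_scope.

Section measurable_rV.
Context (R : realType) (n : nat).

Definition rV_coord (i : 'I_n) (x : 'rV[R]_n) : R := x ord0 i.

Let rV_set0 : g_sigma_preimage rV_coord set0.
Proof. exact: sigma_algebra0. Qed.

Let rV_setC A : g_sigma_preimage rV_coord A -> g_sigma_preimage rV_coord (~` A).
Proof. exact: sigma_algebraC. Qed.

Let rV_bigcup (F : _^nat) : (forall i, g_sigma_preimage rV_coord (F i)) ->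
  g_sigma_preimage rV_coord (\bigcup_i (F i)).
Proof. exact: sigma_algebra_bigcup. Qed.

(* The product sigma-algebra; it is the Borel one, see [open_measurable_rV]. *)
HB.instance Definition _ := @isMeasurable.Build default_measure_display
  'rV[R]_n (g_sigma_preimage rV_coord) rV_set0 rV_setC rV_bigcup.

Lemma measurable_rV_coord (i : 'I_n) : measurable_fun [set: 'rV[R]_n] (rV_coord i).
Proof.
move=> _ Y mY; rewrite setTI; apply: sub_sigma_algebra => /=.
rewrite -bigcup_seq/=; exists i => /=; first by rewrite mem_index_enum.
by exists Y => //; rewrite setTI.
Qed.

Lemma measurable_fun_rVP d (T : measurableType d) (f : T -> 'rV[R]_n) :
  (forall i, measurable_fun [set: T] (fun x => f x ord0 i)) ->
  measurable_fun [set: T] f.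
Proof.
move=> mf; suff : g_sigma_preimage (fun i => rV_coord i \o f) `<=` measurable.
  rewrite g_sigma_preimage_comp => prefS _ A mA; apply: prefS.
  by exists A.
apply: smallest_sub; first exact: sigma_algebra_measurable.
rewrite -bigcup_seq; apply: bigcup_sub => i _ A [B mB <-].
exact: mf.
Qed.

Lemma open_measurable_rV (A : set 'rV[R]_n) : open A -> measurable A.
Proof.
move=> oA.
pose box (q : 'rV[rat]_n * rat) : set 'rV[R]_n :=
  ball (map_mx (ratr : rat -> R) q.1) (ratr q.2 : R).
have mbox q : measurable (box q).
  have [q0|q0] := ltP 0 (ratr q.2 : R); last first.
    rewrite (_ : box q = set0)//; apply/seteqP; split => // y.
    by rewrite /box -ball_normE /= => /(le_lt_trans (normr_ge0 _)); rewrite ltNge q0.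
  rewrite (_ : box q = \bigcap_(i in [set: 'I_n])
      (rV_coord i @^-1` ball (ratr (q.1 ord0 i) : R) (ratr q.2))); last first.
    apply/seteqP; split => y.
      move=> [_ yq] i _; have := yq ord0 i; rewrite mxE; exact.
    move=> yq; split => // i j; rewrite (ord1 i) mxE; exact: yq.
  apply: fin_bigcap_measurable; first exact: finite_finset.
  move=> i _; rewrite -[X in measurable X]setTI; apply: measurable_rV_coord => //.
  by rewrite ball_itv; exact: measurable_itv.
rewrite (_ : A = \bigcup_(q in [set q | box q `<=` A]) box q); last first.
  apply/seteqP; split => [x Ax|x [q qA qx]]; last exact: qA.
  have [e /= e0 xeA] : nbhs_ball x A by rewrite nbhs_ballE; exact: open_nbhs_nbhs.
  have [r] := rat_in_itvoo (divr_gt0 e0 (ltr0Sn R 1)).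
  rewrite in_itv /= => /andP[r0 re].
  have hq i : {q : rat | `|x ord0 i - ratr q| < ratr r}.
    apply: cid; have [|q] := @rat_in_itvoo R (x ord0 i - ratr r) (x ord0 i + ratr r).
      by rewrite ltrBlDr -addrA ltrDl addr_gt0.
    by rewrite in_itv /= => ?; exists q; rewrite distrC ltr_distl.
  pose q := (\row_i sval (hq i), r).
  have qxi i j : ball ((map_mx ratr q.1 : 'rV[R]_n) i j) (ratr r) (x i j).
    by rewrite (ord1 i) !mxE -ball_normE /= distrC; exact: (svalP (hq j)).
  have qx : box q x by split.
  exists q => //= y [_ qy]; apply: xeA; split => // i j.
  apply: (@le_ball _ _ _ (ratr r + ratr r)).
    by rewrite (splitr e) ltW// ltrD.
  by apply: ball_triangle (qy i j); apply: ball_sym; exact: qxi.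
rewrite bigcup_mkcond; apply: countable_bigcupT_measurable => // q.
by case: ifPn.
Qed.

End measurable_rV.

Section lebesgue_rV.
Context (R : realType).

Definition rV_cons n (p : R * 'rV[R]_n) : 'rV[R]_n.+1 :=
  \row_i oapp (p.2 ord0) p.1 (unlift ord0 i).

Definition rV_uncons n (x : 'rV[R]_n.+1) : R * 'rV[R]_n :=
  (x ord0 ord0, \row_i x ord0 (lift ord0 i)).

Lemma rV_consE0 n (p : R * 'rV[R]_n) : rV_cons p ord0 ord0 = p.1.
Proof. by rewrite mxE unlift_none. Qed.

Lemma rV_consES n (p : R * 'rV[R]_n) i : rV_cons p ord0 (lift ord0 i) = p.2 ord0 i.
Proof. by rewrite mxE liftK. Qed.

Lemma rV_consK n : cancel (@rV_cons n) (@rV_uncons n).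
Proof.
move=> [t x]; congr pair; first exact: rV_consE0.
by apply/rowP => i; rewrite mxE rV_consES.
Qed.

Lemma measurable_rV_cons n : measurable_fun [set: R * 'rV[R]_n] (@rV_cons n).
Proof.
apply: measurable_fun_rVP => i; have [j ->|->] := unliftP ord0 i.
  under eq_fun do rewrite rV_consES.
  exact: measurableT_comp (measurable_rV_coord j) measurable_snd.
by under eq_fun do rewrite rV_consE0; exact: measurable_fst.
Qed.

Lemma measurable_rV_uncons n : measurable_fun [set: 'rV[R]_n.+1] (@rV_uncons n).
Proof.
apply/measurable_fun_pairP; split => /=; first exact: measurable_rV_coord.
apply: measurable_fun_rVP => i /=.
under eq_fun do rewrite mxE; exact: measurable_rV_coord.
Qed.

Section push.
Context n (m : {sigma_finite_measure set 'rV[R]_n -> \bar R}).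

Let lebR : {sigma_finite_measure set (measurableTypeR R) -> \bar R} :=
  @lebesgue_measure R.

Definition lebesgue_cons : set 'rV[R]_n.+1 -> \bar R :=
  pushforward (lebR \x m)%E (@rV_cons n).

Let lebesgue_cons0 : lebesgue_cons set0 = 0%E.
Proof. by rewrite /lebesgue_cons /pushforward preimage_set0 measure0. Qed.

Let lebesgue_cons_ge0 A : (0 <= lebesgue_cons A)%E.
Proof. by rewrite /lebesgue_cons /pushforward measure_ge0. Qed.

Let lebesgue_cons_sigma_additive : semi_sigma_additive lebesgue_cons.
Proof.
move=> F mF tF mUF; rewrite /lebesgue_cons /pushforward preimage_bigcup.
have mpre A : measurable A -> measurable (@rV_cons n @^-1` A).
  by move=> mA; rewrite -[X in measurable X]setTI; exact: measurable_rV_cons.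
apply: measure_semi_sigma_additive.
- by move=> k; exact: mpre.
- apply/trivIsetP => /= i j _ _ ij; rewrite -preimage_setI.
  by move/trivIsetP : tF => /(_ _ _ _ _ ij) ->//; rewrite preimage_set0.
- by rewrite -preimage_bigcup; exact: mpre.
Qed.

HB.instance Definition _ := isMeasure.Build _ _ _ lebesgue_cons
  lebesgue_cons0 lebesgue_cons_ge0 lebesgue_cons_sigma_additive.

Let lebesgue_cons_sigma_finite : sigma_finite [set: _] lebesgue_cons.
Proof.
have /sigma_finiteP[F [UF ndF Foo]] := sigma_finiteT lebR.
have /sigma_finiteP[G [UG ndG Goo]] := sigma_finiteT m.
exists (fun k => @rV_uncons n @^-1` (F k `*` G k)).
  rewrite -preimage_bigcup (_ : \bigcup_k _ = [set: _]) ?preimage_setT//.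
  apply/seteqP; split => // -[x y] _.
  have [[i _ Fix] [j _ Gjy]] : (\bigcup_k F k) x /\ (\bigcup_k G k) y.
    by rewrite -UF -UG.
  exists (maxn i j) => //; split.
    by move: x Fix; exact/subsetPset/ndF/leq_maxl.
  by move: y Gjy; exact/subsetPset/ndG/leq_maxr.
move=> k; have [mF Fk] := Foo k; have [mG Gk] := Goo k; split.
  rewrite -[X in measurable X]setTI; apply: measurable_rV_uncons => //.
  exact: measurableX.
rewrite /lebesgue_cons /pushforward -comp_preimage (_ : _ \o _ = id).
  by rewrite /= product_measure1E// lte_mul_pinfty// ge0_fin_numE.
by apply/funext => p /=; rewrite rV_consK.
Qed.

HB.instance Definition _ := Measure_isSigmaFinite.Build _ _ _ lebesgue_cons
  lebesgue_cons_sigma_finite.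

End push.

Fixpoint lebesgue_rV n : {sigma_finite_measure set 'rV[R]_n -> \bar R} :=
  if n is n'.+1 then lebesgue_cons (lebesgue_rV n')
  else @dirac _ 'rV[R]_0 0 R.

Lemma lebesgue_rV_box n (a b : 'I_n -> R) : (forall i, a i <= b i) ->
  lebesgue_rV n [set x | forall i, x ord0 i \in `[a i, b i]] =
  (\prod_i (b i - a i))%:E.
Proof.
elim: n a b => [|n IH] a b ab.
  by rewrite big_ord0 /= diracE mem_set// => -[].
have mbox : measurable
    [set x : 'rV[R]_n | forall i, x ord0 i \in `[a (lift ord0 i), b (lift ord0 i)]].
  rewrite (_ : mkset _ = \bigcap_(i in [set: 'I_n])
      (@rV_coord R n i @^-1` `[a (lift ord0 i), b (lift ord0 i)])).
    apply: fin_bigcap_measurable; first exact: finite_finset.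
    by move=> i _; rewrite -[X in measurable X]setTI; exact: measurable_rV_coord.
  by apply/seteqP; split => [x xab i _|x xab i]; exact: xab.
rewrite big_ord_recl EFinM -(IH (a \o lift ord0) (b \o lift ord0)) //=.
rewrite /lebesgue_cons /pushforward.
rewrite (_ : _ @^-1` _ = `[a ord0, b ord0]%classic `*`
    [set x : 'rV[R]_n | forall i, x ord0 i \in `[a (lift ord0 i), b (lift ord0 i)]]).
  rewrite product_measure1E//=.
  by rewrite lebesgue_measure_itv/= lte_fin; case: ltgtP (ab ord0) => // -> _;
    rewrite subrr mul0e.
apply/seteqP; split => -[t x] /=.
  move=> xab; split => [|i]; first by have := xab ord0; rewrite rV_consE0.
  by have := xab (lift ord0 i); rewrite rV_consES.
move=> [tab xab] i; have [j ->|->] := unliftP ord0 i; last by rewrite rV_consE0.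
by rewrite rV_consES; exact: xab.
Qed.

End lebesgue_rV.

Section domains.
Context (R : realType) (n : nat).
Implicit Types (f : 'rV[R]_n -> R) (A : set 'rV[R]_n).

Definition basis_vec (i : 'I_n) : 'rV[R]_n := delta_mx ord0 i.

Definition partial (i : 'I_n) f : 'rV[R]_n -> R := fun x => 'D_(basis_vec i) f x.

Fixpoint Ck (k : nat) f : Prop :=
  continuous f /\
  (if k is k'.+1 then
     (forall i x, derivable f x (basis_vec i)) /\ (forall i, Ck k' (partial i f))
   else True).

Definition smooth f := forall k, Ck k f.

(* Every loop in [A] contracts to its base point within [A]. *)
Definition simply_connected A :=
  forall gam : R -> 'rV[R]_n,
    {within `[0, 1], continuous gam} -> gam @` `[0, 1] `<=` A -> gam 0 = gam 1 ->
  exists H : R * R -> 'rV[R]_n,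
    [/\ {within `[0, 1] `*` `[0, 1], continuous H},
        H @` (`[0, 1] `*` `[0, 1]) `<=` A,
        (forall t, t \in `[0, 1] -> H (0, t) = gam t /\ H (1, t) = gam 0) &
        (forall r, r \in `[0, 1] -> H (r, 0) = gam 0 /\ H (r, 1) = gam 0)].

(* Near each boundary point, [A] is one side of the graph of a [C^2] function
   of the coordinates other than the [i]-th; the sign [(-1) ^+ b] allows for
   reorienting the [i]-th axis. *)
Definition C2_boundary A :=
  forall x, closure A x -> ~ A x ->
  exists (r : R) (i : 'I_n) (b : bool) (gam : 'rV[R]_n -> R),
    [/\ 0 < r, Ck 2 gam, (forall y t, gam (y + t *: basis_vec i) = gam y) &
        forall y, ball x r y -> (A y <-> gam y < (-1) ^+ b * y ord0 i)].

Record domain := Domain {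
  dom_set :> set 'rV[R]_n ;
  dom_open : open dom_set ;
  dom_nonempty : dom_set !=set0 ;
  dom_connected : connected dom_set ;
  dom_bounded : bounded_set dom_set ;
  dom_simply_connected : simply_connected dom_set ;
  dom_C2_boundary : C2_boundary dom_set }.

End domains.

Section L2.
Context (R : realType) (n : nat) (Om : domain R n).
Implicit Types f g u v : 'rV[R]_n -> R.

Definition dom_measure : {measure set 'rV[R]_n -> \bar R} :=
  mrestr (lebesgue_rV R n) (open_measurable_rV (@dom_open _ _ Om)).

(* Elements of [L^2(Omega)] are represented by functions on the whole of [R^n];
   their values outside [Om] are irrelevant. *)
Definition L2 f : Prop := f \in Lfun dom_measure 2%:E.

Definition L2dot f g : R := \int[dom_measure]_x (f x * g x).

Definition L2norm f : R := fine ('N[dom_measure]_2%:E[EFin \o f])%E.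

Definition weakly_cvg (F : set_system R) (u_ : R -> 'rV[R]_n -> R) u :=
  (\forall d \near F, L2 (u_ d)) /\
  forall psi, L2 psi -> L2dot (u_ d) psi @[d --> F] --> L2dot u psi.

Definition test_function f :=
  smooth f /\
  exists K : set 'rV[R]_n, [/\ compact K, K `<=` Om & forall x, ~ K x -> f x = 0].

Definition weak_partial (i : 'I_n) u v :=
  forall f, test_function f -> L2dot u (partial i f) = - L2dot v f.

Definition H1 u := L2 u /\ forall i, exists2 v, L2 v & weak_partial i u v.

Definition H2 u := L2 u /\ forall i, exists2 v, H1 v & weak_partial i u v.

Definition H10 u :=
  H1 u /\
  exists f_ : nat -> 'rV[R]_n -> R,
    [/\ forall m, test_function (f_ m),
        L2norm (f_ m \- u) @[m --> \oo] --> 0 &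
        forall i v, L2 v -> weak_partial i u v ->
          L2norm (partial i (f_ m) \- v) @[m --> \oo] --> 0].

Record diff_op := DiffOp {
  op_a : 'I_n -> 'I_n -> 'rV[R]_n -> R ;
  op_b : 'I_n -> 'rV[R]_n -> R ;
  op_c : 'rV[R]_n -> R }.

Variable L : diff_op.

(* Regularity up to the boundary: the coefficients are restrictions to [Om] of
   functions defined on the whole space. *)
Definition smooth_coefficients :=
  [/\ forall i j, Ck 1 (op_a L i j), forall i, Ck 0 (op_b L i) & Ck 0 (op_c L)].

Definition uniformly_elliptic :=
  exists2 th : R, 0 < th & forall x, dom_set Om x -> forall xi : 'rV[R]_n,
    th * (\sum_i xi ord0 i ^+ 2) <=
    \sum_i \sum_j op_a L i j x * xi ord0 i * xi ord0 j.

(* [u] is in the domain [H^2 /\ H^1_0] of the operator, and [f] is (a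
   representative of) its image [L u]. *)
Definition op_graph u f :=
  [/\ H2 u, H10 u, L2 f &
   exists (Du : 'I_n -> 'rV[R]_n -> R) (D2u : 'I_n -> 'I_n -> 'rV[R]_n -> R),
   [/\ forall i, L2 (Du i) /\ weak_partial i u (Du i),
       forall i j, L2 (D2u i j) /\ weak_partial j (Du i) (D2u i j) &
       {ae dom_measure, forall x, f x =
          \sum_i \sum_j op_a L i j x * D2u i j x +
          \sum_i op_b L i x * Du i x + op_c L x * u x}]].

(* The graph is equal to that of the adjoint. *)
Definition self_adjoint :=
  forall v h, L2 v -> L2 h ->
    (op_graph v h <-> forall u f, op_graph u f -> L2dot f v = L2dot u h).

Definition opp_positive :=
  forall u f, op_graph u f -> L2norm u != 0 -> 0 < L2dot (\- f) u.

Definition elliptic_operator :=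
  [/\ smooth_coefficients, uniformly_elliptic, self_adjoint & opp_positive].

Variables (lam : nat -> R) (phi : nat -> 'rV[R]_n -> R).

(* The eigenvalues are numbered from [0]. That the orthonormal family [phi] is
   a basis says that every eigenvalue is listed, according to multiplicity. *)
Definition eigen_system :=
  [/\ 0 < lam 0, {homo lam : i j / (i <= j)%N >-> i <= j},
      forall k, op_graph (phi k) (fun x => - (lam k * phi k x)),
      forall i j, L2dot (phi i) (phi j) = (i == j)%:R &
      forall f, L2 f ->
        L2norm ((fun x => \sum_(k < N) L2dot f (phi k) * phi k x) \- f)
          @[N --> \oo] --> 0].

(* The sum in [L^2] of the series [\sum_k m (lam k) <f, phi k> phi k], and [0] if
   the series diverges. *)
Definition spectral (m : R -> R) f : 'rV[R]_n -> R :=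
  xget (cst 0) [set u | L2 u /\
    L2norm ((fun x => \sum_(k < N) m (lam k) * L2dot f (phi k) * phi k x) \- u)
      @[N --> \oo] --> 0].

Definition opp_power (beta : R) f := spectral (fun l => l `^ beta) f.

Definition semigroup (T : R) f := spectral (fun l => expR (- (l * T))) f.

Definition dotH (r : R) v :=
  L2 v /\
  (\sum_(k <oo) (lam k `^ r * L2dot v (phi k) ^+ 2)%:E < +oo)%E.

Fixpoint landweber (mu s : R) f (i : nat) : 'rV[R]_n -> R :=
  if i is i'.+1 then
    landweber mu s f i' \-
      mu \*: opp_power (- (2 * s)) (landweber mu s f i' \- f)
  else cst 0.

End L2.

Section mittag_leffler.
Context (R : realType).

Definition Gamma (x : R) : R :=
  \int[@lebesgue_measure R]_(t in `]0, +oo[) (t `^ (x - 1) * expR (- t)).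

Definition mittag_leffler (a z : R) : R :=
  limn (series (fun k => z ^+ k / Gamma (a * k%:R + 1))).

End mittag_leffler.

Definition frac_backward (R : realType) (n : nat) (Om : domain R n)
    (lam : nat -> R) (phi : nat -> 'rV[R]_n -> R) (T a : R) (f : 'rV[R]_n -> R) :
    'rV[R]_n -> R :=
  spectral Om lam phi (fun l => (mittag_leffler a (- (l * T `^ a)))^-1) f.

Definition comparable_near0 (R : realType) (X Y : R -> R) :=
  exists c C : R, [/\ 0 < c, c <= C &
    \forall d \near 0^'+, c * Y d <= X d <= C * Y d].

(* Main.v *)
(* In the eigenbasis everything is scalar: with [e = exp (- l T)],
   [E = E_(alpha,1) (- l T ^ alpha)], [eps = 1 - alpha] and [q = 1 / (2 p)], the
   regularized solution has coefficients [t / E] and the discrepancy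
   [(e / E - 1) t], where [t] is the Landweber-smoothed datum. Two bounds, uniform
   in [alpha] and in the eigenvalue [l], suffice: [1 / E = O(l / eps)] and
   [E - e = O(eps l ^ q)]. They give [|discrepancy| = O(eps) + O(i ^ theta delta)]
   with [theta < 1 / 2], so that the noise term is negligible against [td] and the
   lower discrepancy bound yields [td = O(eps)]; then the amplified noise, of size
   [i ^ theta delta / eps], is bounded, and so are the regularized solutions. The
   upper discrepancy bound gives convergence of each coefficient, hence weak
   convergence.

   The two bounds come from the Grunwald-Letnikov discretization of fractional
   relaxation, whose solution tends to [E]: its maximum principle makes it
   comparable with explicit subsolutions and with the implicit Euler
   scheme, which tends to [e]. *)

Require Import Defs.
From HB Require Import structures.
From mathcomp Require Import all_boot all_order all_algebra.
From mathcomp Require Import all_classical all_reals all_analysis.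
From mathcomp Require Import measurable_realfun ring lra.
Set Implicit Arguments.
Unset Strict Implicit.
Unset Printing Implicit Defensive.
Import Order.TTheory GRing.Theory Num.Theory.
Import numFieldNormedType.Exports.
Local Open Scope classical_set_scope.
Local Open Scope ring_scope.

(** The obstacle is that [alpha] is picked by the discrepancy, so its distance to 1 is known only
    through the residual, while the amplification 1 / E may grow like 1 / eps. Convergence of
    [alpha] to 1 is never derived: a coefficient of fixed index is recovered from the residual by
    dividing by e > 0, and only the norm bound has to be uniform. The exponents are forced as
    follows. In (E - e) / E the factors eps cancel and O(l ^ (1 + q)) remains; Landweber smoothing
    must absorb this power, whence theta = (1 + q) / (2 s), and theta < 1 / 2 means s > 1 + q. A
    positive q is what pays for the logarithm of l: the kernels t ^ (- eps) and 1 differ by about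
    eps |ln t|, and the relevant times go down to 1 / l. The discrete scheme keeps every identity
    finite. Fractional powers of the difference operator are Cauchy products with binomial
    sequences, which compose by adding exponents, and iterating the scheme produces a sum whose
    terms tend to those of the Mittag-Leffler series. *)

Section tangent_inequalities.
Variable R : realType.
Implicit Types w x y t : R.

Lemma ln_le_subr1 x : 0 < x -> ln x <= x - 1.
Proof.
move=> x0; have := @expR_ge1Dx R (ln x); rewrite lnK ?posrE// => h.
by rewrite lerBrDl.
Qed.

Lemma powRN_tangent w y : 0 < w -> 0 <= y -> 1 - y * (w - 1) <= w `^ (- y).
Proof.
move=> w0 y0; rewrite /powR gt_eqF//.
apply: (le_trans _ (expR_ge1Dx _)).
by rewrite lerD2l mulNr lerN2 ler_wpM2l// ln_le_subr1.
Qed.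

Lemma powR_tangent_inv w y : 0 < w -> 0 <= y -> 1 + y * (1 - w^-1) <= w `^ y.
Proof.
move=> w0 y0; have := @powRN_tangent w^-1 y; rewrite invr_gt0 => /(_ w0 y0).
rewrite -(powR_inv1 (ltW w0)) -powRrM mulrNN mul1r => h; apply: le_trans h.
by rewrite -[X in _ <= 1 - y * X](opprB 1) mulrN opprK.
Qed.

Lemma powRV w y : 0 <= w -> w^-1 `^ y = w `^ (- y).
Proof. by move=> w0; rewrite -(powR_inv1 w0) -powRrM mulN1r. Qed.

Lemma powR_ratio x w y : 0 < x -> 0 < w -> w `^ y = x `^ y * (w / x) `^ y.
Proof.
move=> x0 w0; rewrite -powRM ?(ltW x0) ?divr_ge0 ?ltW//.
by rewrite mulrC divfK ?gt_eqF.
Qed.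

(** Weighted AM-GM. [M] is the mean of w and 1 with weights t and 1 - t; the tangent bounds of ln at
    w / M and 1 / M, averaged with the same weights, have right-hand sides that sum to 0, which
    leaves t ln w <= ln M. *)
Lemma powR_concave w t : 0 <= w -> 0 <= t <= 1 -> w `^ t <= 1 + t * (w - 1).
Proof.
rewrite le_eqVlt => /predU1P[<-|w0] /andP[t0 t1].
  have [->|t0'] := eqVneq t 0; first by rewrite powRr0 mul0r addr0.
  by rewrite powR0//; lra.
set M := 1 + _; have M0 : 0 < M.
  rewrite (_ : M = (1 - t) + t * w); last by rewrite /M; ring.
  have [->|t0'] := eqVneq t 0; first by rewrite mul0r subr0 addr0.
  by rewrite ltr_wpDl ?subr_ge0// mulr_gt0// lt0r t0' t0.
rewrite -ler_ln ?posrE ?powR_gt0// ln_powR.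
have h1 : ln w - ln M <= w / M - 1.
  by rewrite -ln_div ?posrE// ln_le_subr1// divr_gt0.
have h2 : - ln M <= M^-1 - 1.
  by rewrite -lnV ?posrE// ln_le_subr1// invr_gt0.
have h1' := ler_wpM2l t0 h1.
have t1' : 0 <= 1 - t by rewrite subr_ge0.
have h2' := ler_wpM2l t1' h2.
have E : t * (w / M - 1) + (1 - t) * (M^-1 - 1) = 0.
  have -> : t * (w / M - 1) + (1 - t) * (M^-1 - 1) = M / M - 1.
    by rewrite /M; ring.
  by rewrite divff ?gt_eqF// subrr.
lra.
Qed.

End tangent_inequalities.

(** * Cauchy products of sequences *)

Section sequences_as_power_series.
Variable R : realType.
Implicit Types f g h u v : nat -> R.

Definition conv f g n : R := \sum_(i < n.+1) f i * g (n - i)%N.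

(** Only indices up to n enter the n-th term, so truncation at any N > n turns the Cauchy product
    into a product of polynomials; commutativity and associativity of [conv] are inherited from
    there. *)
Lemma conv_poly f g n N : (n < N)%N ->
  conv f g n = ((\poly_(i < N) f i) * (\poly_(i < N) g i))`_n.
Proof.
move=> nN; rewrite coefM; apply: eq_bigr => i _.
have iN : (i < N)%N by rewrite (leq_ltn_trans _ nN)// -ltnS.
by rewrite !coef_poly iN (leq_ltn_trans (leq_subr i n) nN).
Qed.

Lemma convC f g : conv f g =1 conv g f.
Proof. by move=> n; rewrite !(@conv_poly _ _ n n.+1)// mulrC. Qed.

Lemma eq_conv f f' g g' n : (forall m, (m <= n)%N -> f m = f' m) ->
  (forall m, (m <= n)%N -> g m = g' m) -> conv f g n = conv f' g' n.
Proof.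
move=> ff gg; apply: eq_bigr => i _.
by rewrite ff ?gg ?leq_subr// -ltnS.
Qed.

Lemma convA f g h : conv f (conv g h) =1 conv (conv f g) h.
Proof.
move=> n; transitivity (((\poly_(i < n.+1) f i) *
   ((\poly_(i < n.+1) g i) * (\poly_(i < n.+1) h i)))`_n).
  rewrite coefM; apply: eq_bigr => i _.
  by rewrite coef_poly ltn_ord (@conv_poly _ _ _ n.+1)// ltnS leq_subr.
rewrite mulrA coefM; apply: eq_bigr => i _.
rewrite (@conv_poly _ _ _ n.+1)// ?coef_poly.
by rewrite ltnS leq_subr.
Qed.

Lemma convDr f g h n : conv f (fun m => g m + h m) n = conv f g n + conv f h n.
Proof. by rewrite -big_split; apply: eq_bigr => i _; rewrite mulrDr. Qed.

Lemma convZr f g c n : conv f (fun m => c * g m) n = c * conv f g n.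
Proof. by rewrite mulr_sumr; apply: eq_bigr => i _; rewrite mulrCA. Qed.

Lemma convBr f g h n : conv f (fun m => g m - h m) n = conv f g n - conv f h n.
Proof.
rewrite -[X in _ = _ + X]mulN1r -convZr -convDr.
by apply: eq_conv => // m _; rewrite mulN1r.
Qed.

Lemma conv_recr f g n :
  conv f g n = f 0%N * g n + \sum_(i < n) f i.+1 * g (n - i.+1)%N.
Proof. by rewrite /conv big_ord_recl subn0. Qed.

(** Division of power series by one with nonzero constant term. [pref] accumulates the list of
    coefficients found so far, since each new one depends on all of them. *)
Lemma conv_solve f g : f 0%N != 0 -> exists u, forall n, conv f u n = g n.
Proof.
move=> f0.
pose step n (s : seq R) :=
  (g n - \sum_(i < n) f i.+1 * nth 0 s (n - i.+1)) / f 0%N.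
pose fix pref n := if n is n'.+1 then rcons (pref n') (step n' (pref n')) else [::].
have spref n : size (pref n) = n by elim: n => //= n IH; rewrite size_rcons IH.
have prefE n m : (n <= m)%N -> forall k, (k < n)%N -> nth 0 (pref m) k = nth 0 (pref n) k.
  elim: m => [|m IH]; first by rewrite leqn0 => /eqP ->.
  rewrite leq_eqVlt => /predU1P[->//|]; rewrite ltnS => nm k kn /=.
  by rewrite nth_rcons spref (leq_trans kn nm) IH.
exists (fun n => nth 0 (pref n.+1) n) => n; rewrite conv_recr.
rewrite [X in f 0%N * X]/= nth_rcons spref ltnn eqxx /step mulrC divfK//.
rewrite -[RHS]addr0 -addrA; congr (_ + _); apply/eqP; rewrite addrC subr_eq0; apply/eqP.
apply: eq_bigr => i _; rewrite (@prefE (n - i.+1).+1 n)//.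
by rewrite ltn_subrL /= (leq_ltn_trans _ (ltn_ord i)).
Qed.

End sequences_as_power_series.

(** * Binomial coefficients *)

Section binomial_coefficients.
Variable R : realType.
Implicit Types a b c e : R.

(* The coefficient of [z ^ n] in [(1 - z) `^ (- b)]. *)
Definition bincoef b n : R := \prod_(i < n) ((i%:R + b) / i.+1%:R).

Lemma bincoef0 b : bincoef b 0 = 1.
Proof. by rewrite /bincoef big_ord0. Qed.

Lemma bincoefS b n : bincoef b n.+1 = bincoef b n * ((n%:R + b) / n.+1%:R).
Proof. by rewrite /bincoef big_ord_recr. Qed.

Lemma bincoefSr b n : n.+1%:R * bincoef b n.+1 = (n%:R + b) * bincoef b n.
Proof. by rewrite bincoefS; field; rewrite addrC natr1 pnatr_eq0. Qed.

Lemma bincoef_ge0 b n : 0 <= b -> 0 <= bincoef b n.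
Proof. by move=> b0; apply: prodr_ge0 => i _; rewrite divr_ge0// addr_ge0. Qed.

Lemma bincoef_gt0 b n : 0 < b -> 0 < bincoef b n.
Proof. by move=> b0; apply: prodr_gt0 => i _; rewrite divr_gt0// ltr_wpDl. Qed.

Lemma bincoef_of0 n : bincoef 0 n = (n == 0)%:R.
Proof.
case: n => [|n]; first by rewrite bincoef0.
by rewrite /bincoef big_ord_recl add0r mul0r mul0r.
Qed.

Lemma bincoef_of1 n : bincoef 1 n = 1.
Proof. by rewrite /bincoef big1// => i _; rewrite natr1 divff// pnatr_eq0. Qed.

(** This sign is the source of the maximum principle: all past values enter the scheme with
    nonpositive weight. *)
Lemma bincoefN_le0 a n : 0 <= a <= 1 -> bincoef (- a) n.+1 <= 0.
Proof.
move=> /andP[a0 a1]; rewrite /bincoef big_ord_recl add0r.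
rewrite mulr_le0_ge0// ?divr1 ?oppr_le0//.
apply: prodr_ge0 => i _; rewrite divr_ge0// subr_ge0.
by rewrite (le_trans a1)// ler1n.
Qed.

(** Multiplying the n-th coefficient by n is the derivation z d/dz. Writing n + 1 as i + (n + 1 - i)
    is the Leibniz rule, and [bincoefSr] is the equation (1 - z) F' = b F of F = (1 - z) ^ (- b). *)
Lemma conv_bincoef b c : conv (bincoef b) (bincoef c) =1 bincoef (b + c).
Proof.
elim=> [|n IH]; first by rewrite /conv big_ord1 !bincoef0 mulr1.
apply: (@mulfI _ n.+1%:R); first by rewrite pnatr_eq0.
rewrite bincoefSr -IH /conv.
transitivity (\sum_(i < n.+2) (i%:R * bincoef b i) * bincoef c (n.+1 - i) +
    \sum_(i < n.+2) bincoef b i * ((n.+1 - i)%:R * bincoef c (n.+1 - i))).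
  rewrite mulr_sumr -big_split; apply: eq_bigr => i _ /=.
  rewrite natrB; last by rewrite -ltnS.
  by ring.
rewrite big_ord_recl !mul0r add0r.
rewrite [X in _ + X]big_ord_recr /= subnn !mul0r mulr0 addr0.
rewrite mulr_sumr -big_split; apply: eq_bigr => i _ /=.
have ile : (i <= n)%N by rewrite -ltnS.
rewrite /bump /= add1n bincoefSr subSS subSn// bincoefSr natrB//.
by ring.
Qed.

Lemma sum_bincoef b n : \sum_(i < n.+1) bincoef b i = bincoef (b + 1) n.
Proof.
rewrite -conv_bincoef; apply: eq_bigr => i _.
by rewrite bincoef_of1 mulr1.
Qed.

Lemma bincoef_ge_powR e n : 0 < e < 1 ->
  (1 - e) * n.+1%:R `^ (- e) <= bincoef (1 - e) n.
Proof.
move=> /andP[e0 e1]; have e1' : 0 <= 1 - e by lra.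
case: n => [|n]; first by rewrite bincoef0 powR1 mulr1; lra.
(* From index 1 on, the induction runs on the sharper bound with m ^ (- e) in place of (m + 1) ^ (-
   e): it is an equality at m = 1, and one step of it is exactly [powR_concave] at m / (m + 1). *)
apply: (@le_trans _ _ ((1 - e) * n.+1%:R `^ (- e))).
  rewrite ler_wpM2l// !powRN lef_pV2 ?posrE ?powR_gt0//.
  by apply: ge0_ler_powR; rewrite ?nnegrE// ?ltW// ltr_nat.
elim: n => [|n IH].
  by rewrite bincoefS bincoef0 powR1 add0r divr1 mulr1 mul1r.
rewrite bincoefS.
have n0 : 0 < n.+1%:R :> R by [].
have n1 : 0 < n.+2%:R :> R by [].
have := @powR_concave R (n.+1%:R / n.+2%:R) e.
rewrite divr_ge0// (ltW e0) (ltW e1) => /(_ erefl erefl) H.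
rewrite (@powR_ratio _ n.+1%:R)// [leLHS]mulrA.
apply: ler_pM => //; rewrite ?powR_ge0 ?mulr_ge0 ?powR_ge0//.
rewrite -powRV ?divr_ge0// invf_div; apply: le_trans H _.
rewrite -[n.+2]addn1 natrD le_eqVlt; apply/orP; left; apply/eqP.
by field; rewrite (addrC 1) !natr1 pnatr_eq0.
Qed.

Lemma bincoef_le_powR e n : 0 < e < 1 -> bincoef (1 - e) n <= n.+1%:R `^ (- e).
Proof.
move=> /andP[e0 e1]; have e1' : 0 <= 1 - e by lra.
elim: n => [|n IH]; first by rewrite bincoef0 powR1.
have n0 : 0 < n.+1%:R :> R by [].
have n1 : 0 < n.+2%:R :> R by [].
have := @powRN_tangent R (n.+2%:R / n.+1%:R) e.
rewrite divr_gt0// (ltW e0) => /(_ erefl erefl) H.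
rewrite bincoefS.
rewrite [leRHS](@powR_ratio _ n.+1%:R)//.
apply: ler_pM; [exact: bincoef_ge0|by rewrite divr_ge0// addr_ge0|exact: IH|].
apply: le_trans H; rewrite -[n.+2]addn1 natrD le_eqVlt; apply/orP; left; apply/eqP.
by field; rewrite addrC natr1 pnatr_eq0.
Qed.

(** Comparison of (n + 1) ^ (- e) with the integral of t ^ (- e) over [n, n + 1], written as a
    difference of primitives so that sums telescope. *)
Lemma powRN_le_telescope e n : 0 < e < 1 ->
  (1 - e) * n.+1%:R `^ (- e) <= n.+1%:R `^ (1 - e) - n%:R `^ (1 - e).
Proof.
move=> /andP[e0 e1].
have n0 : 0 < n.+1%:R :> R by [].
have := @powR_concave R (n%:R / n.+1%:R) (1 - e).
rewrite divr_ge0// => /(_ erefl); have -> : 0 <= 1 - e <= 1 by lra.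
move=> /(_ erefl) H.
have -> : n%:R `^ (1 - e) = n.+1%:R `^ (1 - e) * (n%:R / n.+1%:R) `^ (1 - e).
  by rewrite -powRM ?divr_ge0// (mulrC n.+1%:R) divfK ?gt_eqF.
have E : n.+1%:R `^ (- e) = n.+1%:R `^ (1 - e) / n.+1%:R.
  rewrite -[in X in _ = _ / X](@powRr1 _ n.+1%:R)// -powRB; last by apply/implyP => _; rewrite gt_eqF.
  by congr (_ `^ _); ring.
rewrite E -[X in _ <= X - _]mulr1 -[leRHS]mulrBr mulrCA ler_wpM2l ?powR_ge0//.
rewrite lerBrDr -lerBrDl; apply: le_trans H _.
rewrite -[n.+1]addn1 natrD le_eqVlt; apply/orP; left; apply/eqP.
by field; rewrite natr1 pnatr_eq0.
Qed.

End binomial_coefficients.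

(** * A difference scheme for fractional relaxation *)

(* A Grunwald-Letnikov scheme for the fractional relaxation equation
   [D^a u = - x u], [u 0 = 1]; the generating function of its solution is
   [(1 - z) `^ (a - 1) / ((1 - z) `^ a + x)]. *)
Section fractional_scheme.
Variables (R : realType) (a x : R).
Hypotheses (a01 : 0 < a < 1) (x_gt0 : 0 < x).

(** The mesh size h is absorbed in x, which stands for l h ^ a. Solutions are taken with right-hand
    side [bincoef (1 - a)]: it is (1 - z) ^ a applied to the constant sequence 1, that is, the
    initial value moved to the right. *)
Definition gl_op (u : nat -> R) n : R := conv (bincoef (- a)) u n + x * u n.

Lemma gl_opB u v n : gl_op (fun m => u m - v m) n = gl_op u n - gl_op v n.
Proof. by rewrite /gl_op convBr; ring. Qed.

Lemma gl_op_cst c n : gl_op (fun=> c) n = c * bincoef (1 - a) n + x * c.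
Proof.
by rewrite /gl_op /conv -mulr_suml sum_bincoef (addrC (- a)) (mulrC _ c).
Qed.

(** Discrete maximum principle: the current value has weight 1 + x > 0 and the past values,
    nonnegative by induction, have nonpositive weights. The horizon [N] is there because the defect
    estimates that use it hold only up to a finite time. *)
Lemma gl_op_ge0 (u : nat -> R) N :
  (forall n, (n <= N)%N -> 0 <= gl_op u n) -> forall n, (n <= N)%N -> 0 <= u n.
Proof.
move=> H n; have [m] := ubnP n; elim: m n => // m IH n nm nN.
have := H n nN; rewrite /gl_op conv_recr bincoef0 mul1r.
rewrite (_ : u n + _ + _ = u n * (1 + x) +
   \sum_(i < n) bincoef (- a) i.+1 * u (n - i.+1)%N); last by ring.
set S := \sum_(i < n) _; have S0 : S <= 0.
  apply: sumr_le0 => i _; apply: mulr_le0_ge0.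
    by apply: bincoefN_le0; case/andP: a01 => /ltW -> /ltW ->.
  apply: IH; last by rewrite (leq_trans (leq_subr _ _)).
  have n0 : (0 < n)%N := leq_ltn_trans (leq0n i) (ltn_ord i).
  by rewrite (@leq_trans n)// ltn_subrL.
move=> h; rewrite -(@pmulr_lge0 _ (1 + x)); first lra.
by rewrite addr_gt0.
Qed.

Lemma gl_op_le (u v : nat -> R) N : (forall n, (n <= N)%N -> gl_op u n <= gl_op v n) ->
  forall n, (n <= N)%N -> u n <= v n.
Proof.
move=> H n nN; rewrite -subr_ge0.
apply: (@gl_op_ge0 (fun m => v m - u m) N) => // m mN.
by rewrite gl_opB subr_ge0 H.
Qed.

Lemma gl_solution : exists u, gl_op u =1 bincoef (1 - a).
Proof.
have [|u hu] := @conv_solve R (fun n => bincoef (- a) n + x * (n == 0)%:R)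
   (bincoef (1 - a)).
  by rewrite bincoef0 mulr1 gt_eqF// addr_gt0.
exists u => n; rewrite -hu /gl_op [in RHS]convC.
rewrite convDr convZr convC; congr (_ + x * _).
rewrite convC conv_recr mul1r big1 ?addr0 ?subn0// => i _.
by rewrite mul0r.
Qed.

Variable u : nat -> R.
Hypothesis uE : gl_op u =1 bincoef (1 - a).

Lemma gl_sol_ge0 n : 0 <= u n.
Proof.
apply: (@gl_op_ge0 u n) => // m _; rewrite uE bincoef_ge0// subr_ge0.
by case/andP: a01 => _ /ltW.
Qed.

Lemma gl_sol_le1 n : u n <= 1.
Proof.
apply: (@gl_op_le u (fun=> 1) n) => // m _.
by rewrite uE gl_op_cst mul1r mulr1 lerDl ltW.
Qed.

Lemma gl_sol_ge n : bincoef (1 - a) n / (bincoef (1 - a) n + x) <= u n.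
Proof.
have a1 : 0 < 1 - a by case/andP: a01 => _; rewrite subr_gt0.
set b := bincoef _; pose l m := b m / (b m + x).
have b0 m : 0 < b m by apply: bincoef_gt0.
have bx0 m : 0 < b m + x by rewrite addr_gt0.
have bS m : b m.+1 <= b m.
  rewrite /b bincoefS ler_piMr ?(ltW (b0 _))//.
  by rewrite ler_pdivrMr// mul1r -natr1; case/andP: a01 => ? _; lra.
have bl m k : (k <= m)%N -> b m <= b k.
  elim: m => [|m IH]; first by rewrite leqn0 => /eqP ->.
  rewrite leq_eqVlt => /predU1P[->//|]; rewrite ltnS => /IH.
  exact: le_trans (bS m).
have ll m k : (k <= m)%N -> l m <= l k.
  move=> km; rewrite /l ler_pdivrMr// mulrAC ler_pdivlMr//.
  have := bl _ _ km; have := b0 m; have := b0 k; move: x_gt0; nra.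
apply: (@gl_op_le l u n) => // m _; rewrite uE -/b /gl_op.
have -> : b m = l m * b m + x * l m.
  by rewrite (mulrC x) -mulrDr /l divfK// gt_eqF.
rewrite lerD2r.
rewrite (_ : l m * b m = conv (bincoef (- a)) (fun=> l m) m); last first.
  by rewrite /conv -mulr_suml sum_bincoef (addrC (- a)) mulrC.
rewrite !conv_recr bincoef0 !mul1r lerD2l; apply: ler_sum => i _.
apply: ler_wnM2l; last by rewrite ll// leq_subr.
by apply: bincoefN_le0; case/andP: a01 => /ltW -> /ltW ->.
Qed.

(** The scheme convolved with the coefficients of (1 - z) ^ (- a (K + 1)), a discrete fractional
    integration. *)
Lemma gl_sol_recurrence K n :
  conv (bincoef (a * K%:R)) u n =
  bincoef (a * K%:R + 1) n - x * conv (bincoef (a * K.+1%:R)) u n.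
Proof.
have := @eq_conv _ (bincoef (a * K.+1%:R)) (bincoef (a * K.+1%:R)) _ _ n
  (fun _ _ => erefl) (fun m _ => uE m).
rewrite conv_bincoef convDr convZr convA.
rewrite (@eq_conv _ _ (bincoef (a * K.+1%:R - a)) _ u)//; last first.
  by move=> m _; rewrite conv_bincoef.
rewrite (_ : a * K.+1%:R - a = a * K%:R); last by rewrite -natr1; ring.
rewrite (_ : a * K.+1%:R + (1 - a) = a * K%:R + 1); last by rewrite -natr1; ring.
by move=> <-; ring.
Qed.

(** Neumann series of the integrated equation; after rescaling, its k-th term tends to the k-th term
    of the Mittag-Leffler series. *)
Lemma gl_sol_expansion K n :
  u n = \sum_(k < K) (- x) ^+ k * bincoef (a * k%:R + 1) n +
        (- x) ^+ K * conv (bincoef (a * K%:R)) u n.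
Proof.
elim: K => [|K IH].
  rewrite big_ord0 add0r mul1r mulr0 conv_recr bincoef_of0 mul1r.
  by rewrite big1 ?addr0// => i _; rewrite bincoef_of0 mul0r.
by rewrite IH big_ord_recr /= -addrA gl_sol_recurrence exprS; congr (_ + _); ring.
Qed.

(** Since 0 <= u <= 1, the remainder is at most the same fractional integral of the constant 1, that
    is, the absolute value of the first omitted term. *)
Lemma gl_sol_remainder K n :
  `|u n - \sum_(k < K) (- x) ^+ k * bincoef (a * k%:R + 1) n| <=
  x ^+ K * bincoef (a * K%:R + 1) n.
Proof.
have aK : 0 <= a * K%:R by case/andP: a01 => /ltW ? _; rewrite mulr_ge0.
have cge0 : 0 <= conv (bincoef (a * K%:R)) u n.
  by apply: sumr_ge0 => i _; rewrite mulr_ge0 ?gl_sol_ge0 ?bincoef_ge0.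
rewrite {1}(gl_sol_expansion K n) addrC addKr.
rewrite normrM normrX normrN (gtr0_norm x_gt0) (ger0_norm cge0).
rewrite ler_wpM2l ?exprn_ge0 ?(ltW x_gt0)// -sum_bincoef.
apply: ler_sum => i _; rewrite -[leRHS]mulr1.
by rewrite ler_wpM2l ?bincoef_ge0// gl_sol_le1.
Qed.

End fractional_scheme.

(** * Comparison of the fractional scheme with the implicit Euler scheme *)

Section comparison_with_implicit_euler.
Variables (R : realType) (a x y : R).
Hypotheses (a01 : 0 < a < 1) (x_gt0 : 0 < x) (y_gt0 : 0 < y).

(** The case a = 1 of the scheme: the generating function is 1 / ((1 - z) + y), which explains the
    exponent n + 1 at index n. *)
Definition euler n : R := (1 + y) ^- n.+1.

Lemma euler_ge0 n : 0 <= euler n.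
Proof. by rewrite invr_ge0 exprn_ge0// addr_ge0// ltW. Qed.

Lemma euler_le1 n : euler n <= 1.
Proof.
rewrite invf_le1 ?exprn_gt0 ?addr_gt0//.
by rewrite exprn_ege1// lerDl ltW.
Qed.

Lemma euler_sum n : euler n + y * \sum_(i < n.+1) euler i = 1.
Proof.
have y1 : 1 + y != 0 by rewrite gt_eqF// addr_gt0.
have E m : euler m = euler m.+1 * (1 + y).
  by rewrite /euler [in RHS]exprS invfM mulrAC mulVf// mul1r.
elim: n => [|n IH].
  by rewrite big_ord1 /euler expr1; field.
rewrite -[RHS]IH big_ord_recr /= (E n).
by ring.
Qed.

Lemma euler_conv n : euler n + y * conv (bincoef 1) euler n = bincoef 1 n.
Proof.
rewrite bincoef_of1 convC -[RHS](euler_sum n); congr (_ + y * _).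
by apply: eq_bigr => i _; rewrite bincoef_of1 mulr1.
Qed.

(** Residual of [euler] in the integrated fractional equation Z + x (1 - z) ^ (- a) Z = (1 - z) ^ (-
    1). Integration is essential: it leaves two kernels, 1 and a discrete t ^ (a - 1), whose
    difference is small with 1 - a. *)
Definition euler_defect n : R :=
  y * conv (bincoef 1) euler n - x * conv (bincoef a) euler n.

Variable u : nat -> R.
Hypothesis uE : gl_op a x u =1 bincoef (1 - a).

(** The difference u - Z alone would have the fractional derivative of the defect as its source.
    Subtracting the defect too cancels that derivative, and the remaining source involves only the
    defect itself. *)
Lemma gl_op_euler_error n :
  gl_op a x (fun m => u m - euler m - euler_defect m) n = - (x * euler_defect n).
Proof.
have h1 : conv (bincoef (- a)) euler n + y * conv (bincoef (1 - a)) euler n =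
    bincoef (1 - a) n.
  have := @eq_conv _ (bincoef (- a)) (bincoef (- a)) _ _ n
    (fun _ _ => erefl) (fun m _ => euler_conv m).
  rewrite convDr convZr conv_bincoef (addrC (- a)) convA => <-.
  congr (_ + y * _); apply: eq_conv => // m _.
  by rewrite conv_bincoef addrC.
have h2 : conv (bincoef (- a)) euler_defect n =
    y * conv (bincoef (1 - a)) euler n - x * euler n.
  rewrite convBr !convZr !convA; congr (y * _ - x * _).
    by apply: eq_conv => // m _; rewrite conv_bincoef addrC.
  rewrite (@eq_conv _ _ (bincoef 0) _ euler)//; last first.
    by move=> m _; rewrite conv_bincoef addrC subrr.
  rewrite conv_recr bincoef_of0 mul1r big1 ?addr0// => i _.
  by rewrite bincoef_of0 mul0r.
rewrite (gl_opB _ _ (fun m => u m - euler m) euler_defect) (gl_opB _ _ u euler).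
by rewrite uE /gl_op h2 -h1; ring.
Qed.

(** The constants M and - M are super- and subsolutions, because [gl_op] of M is at least x M. The
    factor 2 comes from adding the defect back. *)
Lemma gl_sol_euler M N : (forall n, (n <= N)%N -> `|euler_defect n| <= M) ->
  forall n, (n <= N)%N -> `|u n - euler n| <= M *+ 2.
Proof.
move=> H n nN; have a1 : 0 <= 1 - a by case/andP: a01 => _ /ltW; rewrite subr_ge0.
have M0 : 0 <= M := le_trans (normr_ge0 _) (H n nN).
have b m : 0 <= M * bincoef (1 - a) m by rewrite mulr_ge0// bincoef_ge0.
have key : `|u n - euler n - euler_defect n| <= M.
  rewrite ler_norml; apply/andP; split.
    apply: (@gl_op_le R a x a01 x_gt0 (fun=> - M)
      (fun m => u m - euler m - euler_defect m) N) => // m mN.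
    rewrite gl_op_euler_error gl_op_cst.
    have := H m mN; rewrite ler_norml => /andP[h1 h2].
    have := b m; move: (ler_wpM2l (ltW x_gt0) h2); rewrite mulrN mulNr; lra.
  apply: (@gl_op_le R a x a01 x_gt0
    (fun m => u m - euler m - euler_defect m) (fun=> M) N) => // m mN.
  rewrite gl_op_euler_error gl_op_cst.
  have := H m mN; rewrite ler_norml => /andP[h1 h2].
  have := b m; move: (ler_wpM2l (ltW x_gt0) h1); rewrite mulrN; lra.
rewrite -(subrK (euler_defect n) (u n - euler n)) (le_trans (ler_normD _ _))//.
by rewrite mulr2n lerD// H.
Qed.

End comparison_with_implicit_euler.

(** * Size of the Euler defect, uniformly in the eigenvalue and the mesh *)

Section euler_defect_bound.
Variables (R : realType) (e q : R).
Hypotheses (e_gt0 : 0 < e) (eq_le : e <= q) (q_lt1 : q < 1).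

Let q_gt0 : 0 < q := lt_le_trans e_gt0 eq_le.

(** Here w is a time and c the fractional kernel at that time. For small w the difference behaves
    like e |ln w|; q^-1 w ^ (- q) replaces the logarithm, through w ^ (- e) = (w ^ (- q)) ^ (e / q)
    and concavity, for which e <= q is needed. *)
Lemma dist1_powRN_le (w c S : R) : 0 < w -> w <= S ->
  (1 - e) * w `^ (- e) <= c <= w `^ (- e) ->
  `|1 - c| <= e * (1 + S + q^-1 * w `^ (- q)).
Proof.
move=> w0 wS /andP[cl cu].
have q1 : 0 < q^-1 by rewrite invr_gt0.
have eq1 : e / q <= 1 by rewrite ler_pdivrMr// mul1r.
have hu : w `^ (- e) <= 1 + e / q * w `^ (- q).
  have -> : w `^ (- e) = (w `^ (- q)) `^ (e / q).
    by rewrite -powRrM; congr (_ `^ _); rewrite mulNr mulrCA divff ?mulr1 ?gt_eqF.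
  apply: le_trans (@powR_concave _ _ _ (powR_ge0 _ _) _) _.
    by rewrite eq1 divr_ge0// ltW.
  by rewrite lerD2l ler_wpM2l ?divr_ge0 ?ltW// gtrBl.
have hl : 1 - e * (w - 1) <= w `^ (- e) by rewrite powRN_tangent// ltW.
have p0 : 0 <= q^-1 * w `^ (- q) by rewrite mulr_ge0 ?powR_ge0 ?ltW.
have hu' : w `^ (- e) <= 1 + e * (q^-1 * w `^ (- q)) by rewrite mulrA.
have hu2 : w `^ (- e) <= 1 + q^-1 * w `^ (- q).
  by apply: le_trans hu' _; rewrite lerD2l ler_piMl//; rewrite (le_trans eq_le) ?ltW.
set P := q^-1 * _ in p0 hu' hu2 *; set W := w `^ _ in hu' hu2 cl cu hl *.
have h3 := ler_wpM2l (ltW e_gt0) hu2.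
have h4 := ler_wpM2l (ltW e_gt0) wS.
rewrite ler_norml; apply/andP; split.
  have : 0 <= e * (1 + S).
    by rewrite mulr_ge0 ?ltW// addr_gt0// (lt_le_trans w0).
  by rewrite mulrDr; lra.
have cl' : W - e * W <= c by rewrite -[X in X - _]mul1r -mulrBl.
have hl' : 1 - (e * w - e) <= W by rewrite -[X in _ - (_ - X)]mulr1 -mulrBr.
have h3' : e * W <= e + e * P by move: h3; rewrite mulrDr mulr1.
suff : 1 - c <= e + e * S + e * P by rewrite !mulrDr mulr1.
have aux (e' c' eS' ew' eW' eP' W' : R) : 0 < e' -> eW' <= e' + eP' -> ew' <= eS' ->
  W' - eW' <= c' -> 1 - (ew' - e') <= W' -> 1 - c' <= e' + eS' + eP' by lra.
exact: aux h3' h4 cl' hl'.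
Qed.

(** Riemann sum of t ^ (- q) over 0 < t < 1 / l, whose integral is l ^ (q - 1) / (1 - q). *)
Lemma short_time_sum_le (h l : R) N : 0 < h -> 0 < l ->
  (1 - q) * \sum_(i < N) (if i.+1%:R * h * l < 1 then h * (i.+1%:R * h) `^ (- q) else 0)
   <= l `^ (q - 1).
Proof.
move=> h0 l0; have q1 : 0 <= 1 - q by rewrite subr_ge0 ltW.
have E : l `^ (q - 1) = l^-1 `^ (1 - q) by rewrite powRV ?ltW// opprB.
(* The second bound, in terms of the endpoint N h, carries the induction; the first follows from it
   at an index that still passes the cutoff, where the endpoint is below 1 / l. *)
suff [] : (1 - q) * \sum_(i < N) (if i.+1%:R * h * l < 1 then h * (i.+1%:R * h) `^ (- q) else 0)
   <= l `^ (q - 1) /\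
   (1 - q) * \sum_(i < N) (if i.+1%:R * h * l < 1 then h * (i.+1%:R * h) `^ (- q) else 0)
   <= (N%:R * h) `^ (1 - q) by [].
elim: N => [|N [IH1 IH2]]; first by rewrite big_ord0 mulr0 !powR_ge0.
have N1 : 0 <= N.+1%:R * h by rewrite mulr_ge0// ltW.
have mono : (N%:R * h) `^ (1 - q) <= (N.+1%:R * h) `^ (1 - q).
  apply: ge0_ler_powR; rewrite ?nnegrE ?(mulr_ge0 _ (ltW h0))//.
  by rewrite ler_pM2r// ler_nat.
rewrite big_ord_recr /=; case: ifPn => hN; last first.
  by rewrite addr0; split => //; exact: le_trans mono.
rewrite mulrDr.
have H : (1 - q) * \sum_(i < N) (if i.+1%:R * h * l < 1 then h * (i.+1%:R * h) `^ (- q) else 0)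
    + (1 - q) * (h * (N.+1%:R * h) `^ (- q)) <= (N.+1%:R * h) `^ (1 - q).
  apply: le_trans (lerD IH2 (lexx _)) _.
  rewrite -lerBrDl.
  have -> : (1 - q) * (h * (N.+1%:R * h) `^ (- q)) =
      ((1 - q) * N.+1%:R `^ (- q)) * h `^ (1 - q).
    rewrite powRM ?ltW// powRD; last by apply/implyP => _; rewrite gt_eqF.
    by rewrite powRr1 ?ltW//; ring.
  rewrite !powRM ?(ltW h0)// -mulrBl ler_wpM2r ?powR_ge0//.
  by rewrite powRN_le_telescope// q_gt0.
split => //; apply: le_trans H _; rewrite E.
apply: ge0_ler_powR; rewrite ?nnegrE ?invr_ge0 ?(ltW l0)//.
by rewrite -[leRHS]mul1r ler_pdivlMr// ltW.
Qed.

(** The defect is a sum of Euler weights l h Z against kernel differences, which [dist1_powRN_le]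
    bounds. The term w ^ (- q) is cut at time 1 / l: later it is at most l ^ q and the weights have
    total mass at most 1; earlier Z <= 1 and [short_time_sum_le] gives l ^ q / (1 - q). *)
Lemma euler_defect_le (h l S : R) N : 0 < h -> 0 < l -> N.+1%:R * h <= S ->
  forall n, (n <= N)%N ->
  `|euler_defect (1 - e) (l * h `^ (1 - e)) (l * h) n| <=
  e * (1 + S + q^-1 * (1 + (1 - q)^-1) * l `^ q).
Proof.
move=> h0 l0 NS n nN.
have y0 : 0 < l * h by rewrite mulr_gt0.
have q1 : 0 < 1 - q by rewrite subr_gt0.
have e1 : 0 < e < 1 by rewrite e_gt0 (le_lt_trans eq_le).
pose Z := euler (l * h).
have Z0 i : 0 <= Z i by apply: euler_ge0.
pose w i : R := i.+1%:R * h.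
have w0 i : 0 < w i by rewrite /w mulr_gt0.
have DE : euler_defect (1 - e) (l * h `^ (1 - e)) (l * h) n =
    \sum_(i < n.+1) l * h * Z (n - i)%N * (1 - h `^ (- e) * bincoef (1 - e) i).
  rewrite /euler_defect /conv !mulr_sumr -sumrB; apply: eq_bigr => i _.
  rewrite bincoef_of1 powRD; last by apply/implyP => _; rewrite gt_eqF.
  by rewrite powRr1 ?ltW// -/(Z _); ring.
have ptw i : (i <= n)%N -> `|1 - h `^ (- e) * bincoef (1 - e) i| <=
    e * (1 + S + q^-1 * w i `^ (- q)).
  move=> ni; apply: dist1_powRN_le => //.
    apply: le_trans NS; rewrite ler_wpM2r ?(ltW h0)// ler_nat ltnS.
    exact: leq_trans ni nN.
  rewrite /w powRM ?(ltW h0)//; apply/andP; split.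
    by rewrite mulrA mulrC ler_wpM2l ?powR_ge0// bincoef_ge_powR.
  by rewrite mulrC ler_wpM2r ?powR_ge0// bincoef_le_powR.
rewrite DE (le_trans (ler_norm_sum _ _ _))//.
apply: (@le_trans _ _ (\sum_(i < n.+1) e * (l * h * Z (n - i)%N * (1 + S) +
    q^-1 * (l `^ q * (l * h * Z (n - i)%N) +
     l * (if w i * l < 1 then h * w i `^ (- q) else 0))))).
  apply: ler_sum => i _; rewrite normrM ger0_norm ?(mulr_ge0 (ltW y0))//.
  apply: le_trans (ler_wpM2l _ (ptw i _)) _; first by rewrite (mulr_ge0 (ltW y0)).
    by rewrite -ltnS.
  rewrite mulrCA ler_wpM2l ?(ltW e_gt0)// mulrDr lerD2l mulrCA.
  rewrite ler_wpM2l ?invr_ge0 ?(ltW q_gt0)//.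
  have lZ : 0 <= l * h * Z (n - i)%N by rewrite (mulr_ge0 (ltW y0)).
  case: ifPn => wl.
    rewrite ler_wpDl ?(mulr_ge0 (powR_ge0 _ _) lZ)// [leRHS]mulrA ler_wpM2r ?powR_ge0//.
    by rewrite -[leRHS]mulr1 ler_wpM2l ?(ltW y0)// euler_le1.
  rewrite mulr0 addr0 mulrC ler_wpM2r//.
  rewrite -powRV ?(ltW (w0 i))//; apply: ge0_ler_powR; rewrite ?nnegrE ?invr_ge0 ?(ltW (w0 i)) ?(ltW l0) ?(ltW q_gt0)//.
  by rewrite -[leLHS]mul1r ler_pdivrMr// mulrC leNgt.
rewrite -mulr_sumr ler_wpM2l ?(ltW e_gt0)// big_split /= -mulr_suml -!mulr_sumr.
rewrite big_split /= -!mulr_sumr.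
have sZ : l * h * \sum_(i < n.+1) Z (n - i)%N <= 1.
  rewrite -(euler_sum y0 n) [in leRHS](reindex_inj rev_ord_inj) /=.
  under [in leRHS]eq_bigr do rewrite subSS.
  by rewrite lerDr Z0.
rewrite lerD//.
  by rewrite ler_piMl// addr_ge0// ltW// (lt_le_trans _ NS)// mulr_gt0.
rewrite -[leRHS]mulrA ler_wpM2l ?invr_ge0 ?(ltW q_gt0)// mulrDl mul1r lerD//.
  by rewrite ler_piMr ?powR_ge0.
have := @short_time_sum_le h l n.+1 h0 l0; rewrite -ler_pdivlMl// => H.
apply: le_trans (ler_wpM2l (ltW l0) H) _.
rewrite mulrCA ler_wpM2l ?invr_ge0 ?(ltW q1)//.
by rewrite mulr_powRB1 ?(ltW l0).
Qed.

End euler_defect_bound.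

(** * The Gamma function *)

Section gamma_function.
Variable R : realType.
Local Notation mu := (@lebesgue_measure R).
Implicit Types x y t : R.

(** The exponent is shifted by one from that in [Gamma]: for y >= 0 there is no singularity at 0,
    and the Mittag-Leffler series only involves values at y + 1. *)
Definition gamma_integrand y t : R := t `^ y * expR (- t).

Lemma gamma_integrand_ge0 y t : 0 <= gamma_integrand y t.
Proof. by rewrite mulr_ge0 ?powR_ge0 ?expR_ge0. Qed.

Lemma gamma_integrand_le y : 0 <= y ->
  exists2 C, 0 < C & forall t, 0 <= t -> gamma_integrand y t <= C * expR (- (2^-1 * t)).
Proof.
rewrite le_eqVlt => /predU1P[<-|y0].
  exists 1 => // t t0; rewrite /gamma_integrand powRr0 mul1r mul1r ler_expR; lra.
(* Exponential of the maximum of y ln t - t / 2, attained at t = 2 y; the tangent of ln at that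
   point proves the bound. *)
exists (expR (y * (ln (2 * y) - 1))); first exact: expR_gt0.
move=> t; rewrite le_eqVlt => /predU1P[<-|t0].
  by rewrite /gamma_integrand powR0 ?gt_eqF// mul0r mulr_ge0 ?expR_ge0.
rewrite /gamma_integrand /powR gt_eqF// -!expRD ler_expR.
have y2 : 0 < 2 * y by rewrite mulr_gt0.
have := @ln_le_subr1 R (t / (2 * y)); rewrite divr_gt0// => /(_ erefl).
rewrite ln_div ?posrE// => H.
have := ler_wpM2l (ltW y0) H; rewrite !mulrBr.
have -> : y * (t / (2 * y)) = 2^-1 * t by field; rewrite gt_eqF.
lra.
Qed.

Lemma continuous_gamma_integrand y : 0 <= y ->
  {within `[0, +oo[, continuous (gamma_integrand y)}.
Proof.
move=> y0; apply/continuous_within_itvcyP; split.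
  move=> t; rewrite in_itv /= andbT => t0; apply: cvgM.
    have : {for t, continuous (@powR R ^~ y)} by
      apply: differentiable_continuous; apply/derivable1_diffP;
      apply: derivable_powR; rewrite in_itv /= andbT.
    by apply.
  by apply: (@continuous_comp _ _ _ (fun t => - t)); [exact: oppr_continuous|exact: continuous_expR].
apply: cvgM.
  move: y0; rewrite le_eqVlt => /predU1P[<-|y0].
    by rewrite powRr0; under eq_fun do rewrite powRr0; exact: cvg_cst.
  by rewrite powR0 ?gt_eqF//; exact: powR_cvg0.
apply: cvg_at_right_filter.
by apply: (@continuous_comp _ _ _ (fun t => - t)); [exact: oppr_continuous|exact: continuous_expR].
Qed.

Lemma cvg_expRN_half : expR (- (2^-1 * t)) @[t --> +oo%R] --> (0 : R).
Proof.
apply: (@cvg_comp _ _ _ (fun t => 2^-1 * t) (fun t => expR (- t))); last exact: cvgr_expR.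
by apply: gt0_cvgMry => //; rewrite ?invr_gt0.
Qed.

Lemma integrable_expRN_half :
  mu.-integrable `[0, +oo[ (fun t => (expR (- (2^-1 * t)))%:E).
Proof.
have ce : continuous (fun t : R => expR (- (2^-1 * t))).
  move=> t; apply: (@continuous_comp _ _ _ (fun t => - (2^-1 * t))); last exact: continuous_expR.
  by apply: cvgN; apply: cvgMr; exact: cvg_id.
apply/integrableP; split.
  apply/measurable_EFinP; apply: measurable_funTS.
  exact: continuous_measurable_fun.
under eq_integral do rewrite gee0_abs ?lee_fin ?expR_ge0//.
rewrite (@ge0_continuous_FTC2y _ _ (fun t => - 2 * expR (- (2^-1 * t))) 0 (- 2 * 0)).
- by rewrite -EFinB ltry.
- by move=> x _; exact: expR_ge0.
- exact: continuous_subspaceT.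
- by apply: cvgMr; exact: cvg_expRN_half.
- by move=> x _; apply: ex_derive.
- by apply: cvg_at_right_filter; apply: cvgMr; exact: ce.
- move=> x _; rewrite derive1E derive_val /GRing.scale /=.
  by field.
Qed.

Lemma integrable_gamma_integrand y : 0 <= y ->
  mu.-integrable `[0, +oo[ (EFin \o gamma_integrand y).
Proof.
move=> y0; have [C C0 HC] := gamma_integrand_le y0.
apply: (@le_integrable _ _ R mu `[0, +oo[ _ _ (fun t => (C * expR (- (2^-1 * t)))%:E)) => //.
- apply/measurable_EFinP.
  apply: subspace_continuous_measurable_fun => //.
  exact: continuous_gamma_integrand.
- move=> t /=; rewrite in_itv /= andbT => t0.
  by rewrite lee_fin !ger0_norm ?gamma_integrand_ge0 ?mulr_ge0 ?expR_ge0 ?(ltW C0)// HC.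
- have := @integrableZl _ _ _ mu `[0, +oo[ _ C _ integrable_expRN_half.
  by apply.
Qed.

Lemma GammaE y : 0 <= y ->
  Gamma (y + 1) = \int[mu]_(t in `[0, +oo[) gamma_integrand y t.
Proof.
move=> y0; rewrite /Gamma addrK Rintegral_itv_obnd_cbnd//.
apply: integrableS (integrable_gamma_integrand y0) => //.
by apply: subset_itvr; rewrite bnd_simp.
Qed.

Lemma cvg_gamma_integrand y : 0 <= y -> gamma_integrand y t @[t --> +oo%R] --> (0 : R).
Proof.
move=> y0; have [C C0 HC] := gamma_integrand_le y0.
apply: (@squeeze_cvgr _ _ _ _ (cst 0) (fun t => C * expR (- (2^-1 * t)))).
- apply: filterS (nbhs_pinfty_ge (num_real 0)) => t t0.
  by rewrite gamma_integrand_ge0 /= HC.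
- exact: cvg_cst.
- rewrite -[X in _ --> X](mulr0 C); apply: cvgMr; exact: cvg_expRN_half.
Qed.

Lemma is_derive_gamma_integrand y t : 0 < t ->
  is_derive t 1 (gamma_integrand (y + 1))
    ((y + 1) * gamma_integrand y t - gamma_integrand (y + 1) t).
Proof.
move=> t0; have := @is_derive1_powR R (y + 1) t t0; rewrite addrK => H.
rewrite /gamma_integrand; apply: is_derive_eq.
by rewrite /GRing.scale /=; ring.
Qed.

Lemma GammaS y : 0 <= y -> Gamma (y + 1 + 1) = (y + 1) * Gamma (y + 1).
Proof.
move=> y0; have y1 : 0 < y + 1 by lra.
rewrite !GammaE ?(ltW y1)//.
have i0 := integrable_gamma_integrand y0.
have i1 := integrable_gamma_integrand (ltW y1).
rewrite -RintegralZl//; apply/eqP; rewrite eq_sym -subr_eq0; apply/eqP.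
have i0' : mu.-integrable `[0, +oo[ (EFin \o (fun t => (y + 1) * gamma_integrand y t)).
  by have := @integrableZl _ _ _ mu `[0, +oo[ _ (y + 1) _ i0; apply.
rewrite -RintegralB//.
(* Integration by parts in the form that f, the derivative of [gamma_integrand (y + 1)], has
   integral 0. The half-line is cut at y + 1, where f changes sign, so that f is nonpositive on the
   unbounded piece. *)
pose f t := (y + 1) * gamma_integrand y t - gamma_integrand (y + 1) t.
have fE t : 0 <= t -> f t = (y + 1 - t) * gamma_integrand y t.
  move=> t0; rewrite /f /gamma_integrand powRD ?(gt_eqF y1)// powRr1//; ring.
have cf : {within `[0, +oo[, continuous f}.
  move=> t; apply: cvgB; last exact: (continuous_gamma_integrand (ltW y1)).
  by apply: cvgMr; exact: (continuous_gamma_integrand y0).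
have if_ : mu.-integrable `[0, +oo[ (EFin \o f).
  have := @integrableB _ _ _ mu `[0, +oo[ _ _ _ i0' i1.
  by apply.
have df t : 0 < t -> derivable (gamma_integrand (y + 1)) t 1.
  by move=> t0; apply: ex_derive; exact: is_derive_gamma_integrand.
have dfE t : 0 < t -> (gamma_integrand (y + 1))^`()%classic t = f t.
  by move=> t0; rewrite derive1E; case: (is_derive_gamma_integrand y t0).
have c1 := continuous_gamma_integrand (ltW y1).
have /continuous_within_itvcyP[c1i c10] := c1.
have := @Rintegral_itvB R f (BLeft 0) +oo%O (y + 1) if_.
rewrite bnd_simp (ltW y1) => /(_ erefl erefl) /eqP; rewrite subr_eq => /eqP ->.
rewrite Rintegral_itv_obnd_cbnd; last first.
  by apply: integrableS if_ => //; apply: subset_itvr; rewrite bnd_simp ltW.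
rewrite {1}/Rintegral (@le0_continuous_FTC2y _ _ (gamma_integrand (y + 1)) (y + 1) 0).
- rewrite /Rintegral (@continuous_FTC2 _ f (gamma_integrand (y + 1)))//.
  + rewrite -!EFinB /= /(gamma_integrand _ 0) /gamma_integrand powR0 ?gt_eqF//.
    by rewrite mul0r; ring.
  + by apply: continuous_subspaceW cf; apply: subset_itvl.
  + split.
    * by move=> t; rewrite in_itv /= => /andP[t0 _]; exact: df.
    * exact: c10.
    * apply: cvg_at_left_filter; apply: c1i; by rewrite in_itv /= andbT.
  + by move=> t; rewrite in_itv /= => /andP[t0 _]; exact: dfE.
- move=> t yt; rewrite fE; last by rewrite (le_trans _ yt)// ltW.
  by rewrite mulr_le0_ge0 ?gamma_integrand_ge0// subr_le0.
- by apply: continuous_subspaceW cf; apply: subset_itvr; rewrite bnd_simp ltW.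
- exact: cvg_gamma_integrand (ltW y1).
- by apply: cvg_at_right_filter; apply: c1i; rewrite in_itv /= andbT.
- by move=> t yt; apply: df; exact: lt_trans yt.
- by move=> t; rewrite in_itv /= andbT => yt; apply: dfE; exact: lt_trans yt.
Qed.

End gamma_function.

(** * Growth of the Gamma function *)

Section gamma_function_bounds.
Variable R : realType.
Local Notation mu := (@lebesgue_measure R).
Implicit Types x y t M : R.

Lemma Gamma1 : Gamma (1 : R) = 1.
Proof.
rewrite -[X in Gamma X]add0r GammaE// /Rintegral.
rewrite (@ge0_continuous_FTC2y _ _ (fun t => - expR (- t)) 0 0).
- by rewrite -EFinB /= oppr0 expR0 opprK add0r.
- by move=> t _; exact: gamma_integrand_ge0.
- exact: continuous_gamma_integrand.
- by rewrite -[X in _ --> X]oppr0; apply: cvgN; exact: cvgr_expR.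
- by move=> t _; apply: ex_derive.
- apply: cvg_at_right_filter; apply: cvgN.
  by apply: (@continuous_comp _ _ _ (fun t => - t)); [exact: oppr_continuous|exact: continuous_expR].
- move=> t _; rewrite derive1E derive_val /gamma_integrand powRr0 /GRing.scale /=.
  by ring.
Qed.

(** Keep only the interval [M, M + 1]. M = 1 gives positivity; a large M shows that Gamma outgrows
    any given geometric sequence. *)
Lemma Gamma_ge M y : 0 < M -> 0 <= y -> M `^ y * expR (- (M + 1)) <= Gamma (y + 1).
Proof.
move=> M0 y0; rewrite GammaE//.
have i0 := integrable_gamma_integrand y0.
have sub : `[M, M + 1] `<=` (`[0, +oo[ : set R).
  by move=> t /=; rewrite !in_itv /= andbT => /andP[Mt _]; exact: le_trans (ltW M0) Mt.
apply: (@le_trans _ _ (\int[mu]_(t in `[M, M + 1]) gamma_integrand y t)); last first.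
  apply: fine_le.
  - by apply: integrable_fin_num => //; apply: integrableS i0.
  - exact: integrable_fin_num.
  - apply: ge0_subset_integral => //; first exact: (measurable_int mu).
    by move=> t _; rewrite lee_fin gamma_integrand_ge0.
have muM : mu `[M, M + 1] = 1%E.
  rewrite lebesgue_measure_itv /= lte_fin ltrDl ltr01 -EFinB.
  by rewrite addrAC subrr add0r.
have -> : M `^ y * expR (- (M + 1)) =
    \int[mu]_(t in `[M, M + 1]) (M `^ y * expR (- (M + 1))).
  by rewrite Rintegral_cst// [X in fine X](_ : _ = 1%E) ?mulr1//.
apply: le_Rintegral => //.
- apply/integrableP; split; first exact: measurable_cst.
  by rewrite integral_cst//= lebesgue_measure_itv /= lte_fin ltrDl ltr01 -EFinB ltry.
- by apply: integrableS i0.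
- move=> t /=; rewrite in_itv /= => /andP[Mt tM].
  rewrite /gamma_integrand ler_pM ?powR_ge0 ?expR_ge0 ?ler_expR ?lerN2//.
  by apply: ge0_ler_powR => //; rewrite nnegrE ?(ltW M0)// (le_trans (ltW M0) Mt).
Qed.

Lemma Gamma_gt0 y : 0 <= y -> 0 < Gamma (y + 1).
Proof.
move=> y0; exact: lt_le_trans (@Gamma_ge 1 y _ y0).
Qed.

Lemma bincoef_Gamma y n : 0 <= y ->
  bincoef (y + 1) n * Gamma (y + 1) * n`!%:R = Gamma (n%:R + y + 1).
Proof.
move=> y0; elim: n => [|n IH]; first by rewrite bincoef0 mul1r mulr1 add0r.
have -> : n.+1%:R + y + 1 = n%:R + y + 1 + 1 by rewrite -natr1; ring.
rewrite GammaS ?addr_ge0// -IH bincoefS factS natrM.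
by field; rewrite addrC natr1 pnatr_eq0.
Qed.

Lemma Gamma_nat n : Gamma (n%:R + 1) = n`!%:R :> R.
Proof.
have := @bincoef_Gamma 0 n (lexx _).
by rewrite add0r bincoef_of1 Gamma1 mulr1 mul1r addr0 => ->.
Qed.

Lemma integrable_gamma_integrandZl y c : 0 <= y ->
  mu.-integrable `[0, +oo[ (fun t => (c * gamma_integrand y t)%:E).
Proof. by move=> y0; have := @integrableZl _ _ _ mu `[0, +oo[ _ c _ (integrable_gamma_integrand y0); apply. Qed.

Lemma Gamma_le_combination y z w a b c : 0 < y -> 0 <= z -> 0 <= w ->
  0 <= b -> 0 <= c ->
  (forall t, 0 < t ->
    a * gamma_integrand y t <= b * gamma_integrand z t + c * gamma_integrand w t) ->
  a * Gamma (y + 1) <= b * Gamma (z + 1) + c * Gamma (w + 1).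
Proof.
move=> y0 z0 w0 b0 c0 H; rewrite !GammaE ?(ltW y0)//.
rewrite -!RintegralZl ?integrable_gamma_integrand ?(ltW y0)//.
rewrite -RintegralD ?integrable_gamma_integrandZl//.
apply: le_Rintegral => //.
- by apply: integrable_gamma_integrandZl; exact: ltW.
- have := @integrableD _ _ _ mu `[0, +oo[ _ _ _ (integrable_gamma_integrandZl b z0) (integrable_gamma_integrandZl c w0).
  by apply.
move=> t /=; rewrite in_itv /= andbT le_eqVlt => /predU1P[<-|]; last exact: H.
rewrite {1}/gamma_integrand powR0 ?gt_eqF// mul0r mulr0.
by rewrite addr_ge0// mulr_ge0// gamma_integrand_ge0.
Qed.

(* Integrate the tangent inequality for [(t / n) `^ y] at [t = n] against
   [t ^+ n * expR (- t)]; the next lemma does the same at [t = n + 1 + y]. *)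
Lemma Gamma_ge_fact y n : (0 < n)%N -> 0 <= y ->
  n%:R `^ y * n`!%:R <= Gamma (n%:R + y + 1).
Proof.
case: n => // n _ y0; set N : R := n.+1%:R.
have N0 : 0 < N by [].
have := @Gamma_le_combination N (N + y) n%:R (1 + y) (N `^ (- y)) (y * N).
have Ny : 0 <= N + y by rewrite addr_ge0// ltW.
have yN : 0 <= y * N by rewrite mulr_ge0// ltW.
move=> /(_ N0 Ny (ler0n _ _) (powR_ge0 _ _) yN) H.
have {H} : (1 + y) * (n.+1)`!%:R <= N `^ (- y) * Gamma (N + y + 1) + y * N * n`!%:R.
  rewrite -!Gamma_nat; apply: H => t t0.
  rewrite /gamma_integrand !mulrA -mulrDl ler_wpM2r ?expR_ge0//.
  have t0' : t != 0 by rewrite gt_eqF.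
  rewrite powRD; last by rewrite t0' implybT.
  rewrite !powR_mulrn ?(ltW t0)//.
  have := @powRN_tangent R (N / t) y; rewrite divr_gt0// => /(_ erefl y0).
  have -> : (N / t) `^ (- y) = N `^ (- y) * t `^ y.
    rewrite powRM ?invr_ge0 ?(ltW t0) ?(ltW N0)//.
    by rewrite powRV ?(ltW t0)// opprK.
  move=> H; have := ler_wpM2l (ltW (exprn_gt0 n.+1 t0)) H.
  have -> : t ^+ n.+1 * (1 - y * (N / t - 1)) = (1 + y) * t ^+ n.+1 - y * N * t ^+ n.
    by rewrite exprS; field.
  by rewrite lerBlDr => /le_trans; apply; rewrite lerD2r mulrCA mulrA.
rewrite factS natrM -/N mulrA.
have -> : y * N * n`!%:R = y * (N * n`!%:R) by rewrite mulrA.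
rewrite -lerBlDr -mulrA => H.
have {}H : N * n`!%:R <= N `^ (- y) * Gamma (N + y + 1).
  by apply: le_trans H; rewrite mulrDl mul1r addrK.
by rewrite powRN ler_pdivlMl ?powR_gt0 in H.
Qed.

Lemma Gamma_le_fact y n : 0 <= y ->
  Gamma (n%:R + y + 1) <= (n%:R + y + 1) `^ y * n`!%:R.
Proof.
rewrite le_eqVlt => /predU1P[<-|y0].
  by rewrite powRr0 mul1r addr0 Gamma_nat.
set N := n%:R + y + 1; have N0 : 0 < N by rewrite /N -addrA ltr_wpDl// addr_gt0.
have ny : 0 < n%:R + y by rewrite ltr_wpDl.
have := @Gamma_le_combination (n%:R + y) n%:R N (1 + y) (N `^ y) (y / N).
have yN : 0 <= y / N by rewrite divr_ge0// ltW.
move=> /(_ ny (ler0n _ _) (ltW N0) (powR_ge0 _ _) yN) H.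
have {H} : (1 + y) * Gamma N <= N `^ y * n`!%:R + y / N * Gamma (N + 1).
  rewrite -Gamma_nat; apply: H => t t0.
  rewrite /gamma_integrand !mulrA -mulrDl ler_wpM2r ?expR_ge0//.
  have t0' : t != 0 by rewrite gt_eqF.
  have := @powR_tangent_inv R (N / t) y; rewrite divr_gt0// => /(_ erefl (ltW y0)).
  rewrite invf_div powRM ?invr_ge0 ?(ltW t0) ?(ltW N0)// powRV ?(ltW t0)//.
  move=> H; have := ler_wpM2l (powR_ge0 t (n%:R + y)) H.
  rewrite mulrCA -powRD; last by rewrite t0' implybT.
  rewrite addrK => /(le_trans _); rewrite -lerBlDr; apply.
  rewrite /N [X in _ - _ * X]powRD; last by rewrite t0' implybT.
  rewrite powRr1 ?(ltW t0)// -/N le_eqVlt; apply/orP; left; apply/eqP.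
  by field; rewrite gt_eqF.
rewrite /N GammaS ?(ltW ny)// -/N mulrA divfK ?gt_eqF//.
by rewrite mulrDl mul1r lerD2r.
Qed.

End gamma_function_bounds.

(** * The Mittag-Leffler function *)

Section mittag_leffler_limit.
Variable R : realType.
Implicit Types (a z y : R).

Lemma bincoef_powR_le y n : 0 <= y -> (0 < n)%N ->
  bincoef (y + 1) n * n%:R `^ (- y) <= expR (y * (1 + y) / n%:R) / Gamma (y + 1).
Proof.
move=> y0 n0; have N0 : 0 < n%:R :> R by rewrite ltr0n.
have G0 := Gamma_gt0 y0.
rewrite ler_pdivlMr// mulrAC powRN ler_pdivrMr ?powR_gt0//.
have F0 : 0 < n`!%:R :> R by rewrite ltr0n fact_gt0.
rewrite -(ler_pM2r F0) bincoef_Gamma//.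
apply: le_trans (Gamma_le_fact n y0) _; rewrite ler_pM2r//.
rewrite [leLHS](@powR_ratio _ n%:R)//; last by rewrite -addrA ltr_wpDr// addr_ge0.
rewrite mulrC ler_wpM2r ?powR_ge0//.
rewrite /powR gt_eqF; last by rewrite divr_gt0// -addrA ltr_wpDr// addr_ge0.
rewrite ler_expR -mulrA ler_wpM2l//.
apply: le_trans (ln_le_subr1 _) _.
  by rewrite divr_gt0// -addrA ltr_wpDr// addr_ge0.
rewrite le_eqVlt; apply/orP; left; apply/eqP; field.
by rewrite gt_eqF.
Qed.

Lemma bincoef_powR_ge y n : 0 <= y -> (0 < n)%N ->
  1 / Gamma (y + 1) <= bincoef (y + 1) n * n%:R `^ (- y).
Proof.
move=> y0 n0; have N0 : 0 < n%:R :> R by rewrite ltr0n.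
have G0 := Gamma_gt0 y0.
rewrite ler_pdivrMr// mulrAC powRN ler_pdivlMr ?powR_gt0// mul1r.
have F0 : 0 < n`!%:R :> R by rewrite ltr0n fact_gt0.
by rewrite -(ler_pM2r F0) bincoef_Gamma// Gamma_ge_fact.
Qed.

Lemma cvg_divrn (c : R) : c / n%:R @[n --> \oo] --> (0 : R).
Proof.
rewrite -[X in _ --> X](mulr0 c); apply: cvgMr.
apply/gtr0_cvgV0; last exact: cvgr_idn.
by exists 1%N => // n /= n0; rewrite ltr0n.
Qed.

(** Euler's limit for 1 / Gamma. The quotient Gamma (n + y + 1) / n! lies between n ^ y and (n + y +
    1) ^ y, and the ratio of these bounds is at most exp (y (1 + y) / n). *)
Lemma cvg_bincoef_powR y : 0 <= y ->
  bincoef (y + 1) n * n%:R `^ (- y) @[n --> \oo] --> 1 / Gamma (y + 1).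
Proof.
move=> y0.
apply: (@squeeze_cvgr _ _ _ _ (cst (1 / Gamma (y + 1)))
  (fun n => expR (y * (1 + y) / n%:R) / Gamma (y + 1))).
- exists 1%N => // n /= n0.
  by rewrite bincoef_powR_ge//= bincoef_powR_le.
- exact: cvg_cst.
- apply: cvgMl; rewrite -[X in _ --> X]expR0.
  apply: (@cvg_comp _ _ _ _ (@expR R)); last exact: continuous_expR.
  exact: cvg_divrn.
Qed.

Lemma cvg_sum_ord I (F : set_system I) (FF : Filter F) K (f : nat -> I -> R) (l : nat -> R) :
  (forall k, f k n @[n --> F] --> l k) ->
  \sum_(k < K) f k n @[n --> F] --> \sum_(k < K) l k.
Proof.
move=> fl; elim: K => [|K IH].
  by rewrite big_ord0; under eq_fun do rewrite big_ord0; exact: cvg_cst.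
rewrite big_ord_recr; under eq_fun do rewrite big_ord_recr.
by apply: cvgD; [exact: IH|exact: fl].
Qed.

(** Squeeze by c / (1 + c) <= ln (1 + c) <= c with c = l T / n. Index n amounts to n + 1 steps of
    size T / n; the extra step costs the term [c n] in the lower exponent. *)
Lemma cvg_euler (l T : R) : 0 < l -> 0 < T ->
  euler (l * (T / n%:R)) n @[n --> \oo] --> expR (- (l * T)).
Proof.
move=> l0 T0; have lT : 0 < l * T by rewrite mulr_gt0.
pose c n : R := (l * T) / n%:R.
apply: (@squeeze_cvgr _ _ _ _ (fun n => expR (- (l * T) - c n))
  (fun n => expR (- (l * T) + (l * T) * c n))).
- exists 1%N => // n /= n0; have N0 : 0 < n%:R :> R by rewrite ltr0n.
  have cn0 : 0 < c n by rewrite divr_gt0.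
  have c1 : 0 < 1 + c n by rewrite addr_gt0.
  have -> : euler (l * (T / n%:R)) n = expR (- (n.+1%:R * ln (1 + c n))).
    by rewrite /euler mulrA -/(c n) expRN mulrC expRM_natr lnK.
  rewrite !ler_expR; apply/andP; split.
    rewrite -opprD lerN2.
    apply: le_trans (_ : n.+1%:R * c n <= _).
      rewrite ler_wpM2l//; apply: le_trans (ln_le_subr1 c1) _.
      by rewrite addrC addKr.
    rewrite -natr1 mulrDl mul1r lerD2r /c mulrC divfK// gt_eqF//.
  have h : c n / (1 + c n) <= ln (1 + c n).
    have := @ln_le_subr1 _ (1 + c n)^-1; rewrite invr_gt0 => /(_ c1).
    rewrite lnV ?posrE// => h.
    have -> : c n / (1 + c n) = - ((1 + c n)^-1 - 1) by field; rewrite gt_eqF.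
    by rewrite lerNl.
  have nc : n%:R * c n = l * T by rewrite /c mulrC divfK// gt_eqF.
  rewrite lerNl opprD opprK.
  apply: le_trans (_ : n%:R * (c n / (1 + c n)) <= _); last first.
    apply: le_trans (_ : n.+1%:R * (c n / (1 + c n)) <= _).
      by rewrite ler_wpM2r ?ler_nat// divr_ge0// ltW.
    by rewrite ler_wpM2l.
  rewrite mulrA nc -[X in X - _]mulr1 -mulrBr ler_wpM2l ?(ltW lT)//.
  rewrite -[leRHS]mul1r ler_pdivlMr//; nra.
- rewrite -[X in expR X](subr0 (- (l * T))).
  apply: (@cvg_comp _ _ _ _ (@expR R)); last exact: continuous_expR.
  by apply: cvgB; [exact: cvg_cst|exact: cvg_divrn].
- have {2}-> : - (l * T) = - (l * T) + l * T * 0 by rewrite mulr0 addr0.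
  apply: (@cvg_comp _ _ _ _ (@expR R)); last exact: continuous_expR.
  apply: cvgD; [exact: cvg_cst|apply: cvgMr; exact: cvg_divrn].
Qed.

Lemma cvg_expr_Gamma a z : 0 < a -> 0 < z ->
  z ^+ k / Gamma (a * k%:R + 1) @[k --> \oo] --> 0.
Proof.
(* Chosen so that M ^ (a k) = (2 z) ^ k: the lower bound on Gamma then beats z ^ k by the factor 2 ^
   k. *)
move=> a0 z0; pose M : R := (2 * z) `^ a^-1.
have z2 : 0 < 2 * z by rewrite mulr_gt0.
have M0 : 0 < M by rewrite powR_gt0.
have Ma : M `^ a = 2 * z.
  by rewrite -powRrM mulVf ?gt_eqF// powRr1// ltW.
apply: (@squeeze_cvgr _ _ _ _ (cst 0) (fun k => expR (M + 1) * 2^-1 ^+ k)).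
- apply: nearW => k; have ak : 0 <= a * k%:R by rewrite mulr_ge0// ltW.
  have G0 := Gamma_gt0 ak.
  rewrite divr_ge0 ?exprn_ge0 ?(ltW z0) ?(ltW G0)//=.
  rewrite ler_pdivrMr//; have := Gamma_ge M0 ak.
  rewrite powRrM Ma powR_mulrn ?(ltW z2)// => H.
  apply: le_trans (ler_wpM2l _ H).
    rewrite expRN exprMn exprVn mulrACA.
    rewrite -[X in _ <= X]mulrA.
    by rewrite le_eqVlt; apply/orP; left; apply/eqP; field; rewrite gt_eqF ?expR_gt0// expf_neq0.
  by rewrite mulr_ge0 ?expR_ge0 ?exprn_ge0.
- exact: cvg_cst.
- rewrite -[X in _ --> X](mulr0 (expR (M + 1))); apply: cvgMr.
  apply: cvg_expr; rewrite ger0_norm ?invr_ge0//.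
  by rewrite invf_lt1// ltr1n.
Qed.

(** Mesh T / n, evaluated at index n. For fixed K the Neumann sum [p K n] tends to the partial sum
    [s K], and the remainder has the limit z ^ K / Gamma (a K + 1), which is small for large K. *)
Lemma cvg_gl_sol a l T (u : nat -> nat -> R) : 0 < a < 1 -> 0 < l -> 0 < T ->
  (forall n, (0 < n)%N -> gl_op a (l * (T / n%:R) `^ a) (u n) =1 bincoef (1 - a)) ->
  u n n @[n --> \oo] --> mittag_leffler a (- (l * T `^ a)).
Proof.
move=> a01 l0 T0 uE; have /andP[a0 a1] := a01.
set z := l * T `^ a; have z0 : 0 < z by rewrite mulr_gt0 ?powR_gt0.
pose s K : R := \sum_(k < K) (- z) ^+ k / Gamma (a * k%:R + 1).
have ak k : 0 <= a * k%:R by rewrite mulr_ge0// ltW.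
have xE n k : (0 < n)%N -> (l * (T / n%:R) `^ a) ^+ k = z ^+ k * n%:R `^ (- (a * k%:R)).
  move=> n0; rewrite powRM ?invr_ge0 ?(ltW T0)// powRV// mulrA exprMn -mulNr.
  by rewrite powRrM powR_mulrn ?powR_ge0.
pose p K n : R := \sum_(k < K) (- (l * (T / n%:R) `^ a)) ^+ k * bincoef (a * k%:R + 1) n.
have ps K : p K n @[n --> \oo] --> s K.
  apply: (@cvg_trans _ ((\sum_(k < K) (- z) ^+ k *
     (bincoef (a * k%:R + 1) n * n%:R `^ (- (a * k%:R)))) @[n --> \oo])).
    apply: near_eq_cvg; exists 1%N => // n /= n0; apply: eq_bigr => k _.
    have -> : (- (l * (T / n%:R) `^ a)) ^+ k = (- z) ^+ k * n%:R `^ (- (a * k%:R)).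
      by rewrite -mulN1r exprMn xE// -[X in _ = X ^+ k * _]mulN1r [in RHS]exprMn mulrA.
    by rewrite -mulrA; congr (_ * _); rewrite mulrC.
  have -> : s K = \sum_(k < K) (- z) ^+ k * (1 / Gamma (a * k%:R + 1)).
    by apply: eq_bigr => k _; rewrite mul1r.
  apply: (@cvg_sum_ord _ \oo _ K (fun k n => (- z) ^+ k *
     (bincoef (a * k%:R + 1) n * n%:R `^ (- (a * k%:R))))
     (fun k => (- z) ^+ k * (1 / Gamma (a * k%:R + 1)))) => k.
  by apply: cvgMr; exact: cvg_bincoef_powR.
pose r K n : R := z ^+ K * (bincoef (a * K%:R + 1) n * n%:R `^ (- (a * K%:R))).
have rc K : r K n @[n --> \oo] --> z ^+ K / Gamma (a * K%:R + 1).
  rewrite -[_ / _]mul1r mulrCA; apply: cvgMr; exact: cvg_bincoef_powR.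
have rem K : \forall n \near \oo, `|u n n - p K n| <= r K n.
  exists 1%N => // n /= n0.
  have x0 : 0 < l * (T / n%:R) `^ a by rewrite mulr_gt0// powR_gt0// divr_gt0// ltr0n.
  apply: le_trans (gl_sol_remainder a01 x0 (uE n n0) K n) _.
  by rewrite xE// /r mulrA mulrAC.
have r0 := cvg_expr_Gamma a0 z0.
have close (e : R) : 0 < e -> exists K0, forall K, (K0 <= K)%N ->
    \forall n \near \oo, `|u n n - s K| <= e.
  move=> e0; have e2 : 0 < e / 2 by rewrite divr_gt0.
  have /cvgrPdist_lt/(_ _ e2)[K0 _ HK] := r0.
  exists K0 => K K0K.
  have := HK K K0K; rewrite /= sub0r normrN => /(le_lt_trans (ler_norm _)) HK'.
  near=> n.
  have h1 : `|u n n - p K n| <= r K n by near: n; exact: rem.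
  have h2 : r K n < e / 2 by near: n; exact: (cvgr_lt _ (rc K) _ HK').
  have h3 : `|s K - p K n| < e / 2.
    by near: n; move/cvgrPdist_lt : (ps K); apply.
  rewrite -[u n n](subrK (p K n)) -addrA (le_trans (ler_normD _ _))//.
  rewrite (splitr e) lerD// ?(le_trans h1) ?ltW// distrC//.
have E : series (fun k => (- z) ^+ k / Gamma (a * k%:R + 1)) = s.
  by apply/funext => K; rewrite /series /= /s big_mkord.
(* Convergence of the Mittag-Leffler series is itself a consequence: all late partial sums are close
   to the same [u n n]. *)
have cs : cvgn s.
  apply/cauchy_cvgP; apply: cauchy_exP => _/posnumP[e].
  have e3 : 0 < e%:num / 3 by rewrite divr_gt0.
  have [K0 HK] := close _ e3.
  exists (s K0); exists K0 => // K /= K0K; rewrite -ball_normE /=.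
  have h1 := HK K0 (leqnn _); have h2 := HK K K0K.
  have [n [n1 n2]] := @filter_ex _ \oo _ _ (filterI h1 h2).
  rewrite -(subrK (u n n) (s K0)) -addrA (le_lt_trans (ler_normD _ _))//.
  have e0 : 0 < e%:num by [].
  by rewrite distrC; move: e0 n1 n2; lra.
apply/cvgrPdist_le => e e0.
have e2 : 0 < e / 2 by rewrite divr_gt0.
have [K0 HK] := close _ e2.
have /cvgrPdist_lt/(_ _ e2)[K1 _ HK1] := cs.
pose K := maxn K0 K1.
have h1 := HK K (leq_maxl _ _).
have h2 := HK1 K (leq_maxr _ _).
apply: filterS h1 => n h1.
rewrite /mittag_leffler E.
rewrite -[lim _](subrK (s K)) -addrA (le_trans (ler_normD _ _))//.
rewrite (splitr e) lerD//; [exact: ltW|by rewrite distrC].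
Unshelve. all: by end_near. Qed.

End mittag_leffler_limit.

(** * Bounds on the Mittag-Leffler function, uniform in its order and the eigenvalue *)

Section mittag_leffler_bounds.
Variable R : realType.
Implicit Types (a l T q : R).

Lemma gl_solutions a l T : 0 < a < 1 -> 0 < l -> 0 < T ->
  exists u : nat -> nat -> R, forall n, (0 < n)%N ->
    gl_op a (l * (T / n%:R) `^ a) (u n) =1 bincoef (1 - a).
Proof.
move=> a01 l0 T0.
suff /choice[u hu] : forall n, exists u, (0 < n)%N ->
    gl_op a (l * (T / n%:R) `^ a) u =1 bincoef (1 - a) by exists u.
move=> n; have [->|n0] := posnP n; first by exists (fun=> 0).
have [|u hu] := @gl_solution R a (l * (T / n%:R) `^ a) _.
  by rewrite mulr_gt0// powR_gt0// divr_gt0// ltr0n.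
by exists u.
Qed.

(** Limit of [gl_sol_ge], with the binomial coefficient bounded below by (1 - a) (n + 1) ^ (- a).
    The 2 comes from (n + 1) ^ a <= 2 n ^ a. *)
Lemma mittag_leffler_ge a l T : 0 < a < 1 -> 0 < l -> 0 < T ->
  (1 - a) / (1 - a + 2 * (l * T `^ a)) <= mittag_leffler a (- (l * T `^ a)).
Proof.
move=> a01 l0 T0; have /andP[a0 a1] := a01.
have a1' : 0 < 1 - a by rewrite subr_gt0.
have [u hu] := gl_solutions a01 l0 T0.
have cu := cvg_gl_sol a01 l0 T0 hu.
rewrite -(cvg_lim _ cu)//; apply: limr_ge; first by apply/cvg_ex; eexists; exact: cu.
exists 1%N => // n /= n0.
have x0 : 0 < l * (T / n%:R) `^ a by rewrite mulr_gt0// powR_gt0// divr_gt0// ltr0n.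
apply: le_trans (gl_sol_ge a01 x0 (hu n n0) n).
have z0 : 0 < l * T `^ a by rewrite mulr_gt0// powR_gt0.
have b0 : 0 < bincoef (1 - a) n := bincoef_gt0 n a1'.
have D0 : 0 < 1 - a + 2 * (l * T `^ a) by rewrite addr_gt0// mulr_gt0.
rewrite ler_pdivrMr//. rewrite mulrAC ler_pdivlMr ?addr_gt0//.
rewrite (mulrDr (1 - a)) [leRHS]mulrDr (mulrC (1 - a) (bincoef _ _)) lerD2l.
have hb := bincoef_ge_powR n a01.
apply: le_trans (_ : (1 - a) * n.+1%:R `^ (- a) * (2 * (l * T `^ a)) <= _); last first.
  by rewrite ler_wpM2r// mulr_ge0// ltW.
rewrite -mulrA ler_wpM2l ?(ltW a1')//.
rewrite powRM ?invr_ge0 ?(ltW T0)// powRV//.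
rewrite (_ : l * (T `^ a * n%:R `^ (- a)) = n%:R `^ (- a) * (l * T `^ a)); last by ring.
rewrite [leRHS]mulrA ler_wpM2r ?(ltW z0)// mulrC.
rewrite !powRN ler_pdivlMr ?powR_gt0 ?ltr0n// mulrC ler_pdivrMr ?powR_gt0 ?ltr0n//.
rewrite [leLHS](@powR_ratio _ n%:R) ?ltr0n// mulrC ler_wpM2r ?powR_ge0//.
have N0 : 0 < n%:R :> R by rewrite ltr0n.
have n2 : n.+1%:R / n%:R <= 2 :> R.
  by rewrite ler_pdivrMr// -natrM ler_nat mul2n -addnn -addn1 leq_add2l.
have n1 : 1 <= n.+1%:R / n%:R :> R by rewrite ler_pdivlMr// mul1r ler_nat.
apply: le_trans n2; apply: ler1_powR => //; exact: ltW.
Qed.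

Lemma mittag_leffler_gt0 a l T : 0 < a < 1 -> 0 < l -> 0 < T ->
  0 < mittag_leffler a (- (l * T `^ a)).
Proof.
move=> a01 l0 T0; apply: lt_le_trans (mittag_leffler_ge a01 l0 T0).
have a1' : 0 < 1 - a by rewrite subr_gt0; case/andP: a01.
by rewrite divr_gt0// addr_gt0// mulr_gt0// mulr_gt0// powR_gt0.
Qed.

Lemma mittag_leffler_inv_le l0 T : 0 < l0 -> 0 < T ->
  exists2 C, 0 < C & forall a l, 0 < a < 1 -> l0 <= l ->
    (mittag_leffler a (- (l * T `^ a)))^-1 <= C * l / (1 - a).
Proof.
(* From 1 - a <= 1 <= l / l0 and T ^ a <= 1 + T. *)
move=> l00 T0; exists (l0^-1 + 2 * (1 + T)).
  by rewrite addr_gt0 ?invr_gt0// mulr_gt0// addr_gt0.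
move=> a l a01 ll; have l1 := lt_le_trans l00 ll.
have /andP[a0 a1] := a01; have a1' : 0 < 1 - a by rewrite subr_gt0.
have z0 : 0 < l * T `^ a by rewrite mulr_gt0// powR_gt0.
have D0 : 0 < 1 - a + 2 * (l * T `^ a) by rewrite addr_gt0// mulr_gt0.
apply: (@le_trans _ _ ((1 - a + 2 * (l * T `^ a)) / (1 - a))).
  rewrite -invf_div lef_pV2 ?posrE ?mittag_leffler_gt0 ?divr_gt0//.
  exact: mittag_leffler_ge.
rewrite ler_wpM2r ?invr_ge0 ?(ltW a1')//. rewrite [leRHS]mulrDl lerD//.
  apply: le_trans (_ : 1 <= _); first lra.
  by rewrite mulrC ler_pdivlMr// mul1r.
rewrite -[leRHS]mulrA ler_wpM2l// mulrC ler_wpM2r ?(ltW l1)//.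
have := @powR_concave R T a (ltW T0); rewrite (ltW a0) (ltW a1) => /(_ erefl) /le_trans; apply.
by move: a0 a1 T0; nra.
Qed.

(** For 1 - a <= q this is the limit of the Euler comparison, on the horizon 2 T since (n + 1) T / n
    <= 2 T. For 1 - a > q both values lie in [0, 1], and the summand (q l0 ^ q)^-1 makes the
    right-hand side at least 1. [D] trades the constant 1 + 2 T for a multiple of l ^ q. *)
Lemma mittag_leffler_expR l0 T q : 0 < l0 -> 0 < T -> 0 < q < 1 ->
  exists2 C, 0 < C & forall a l, 0 < a < 1 -> l0 <= l ->
    `|mittag_leffler a (- (l * T `^ a)) - expR (- (l * T))| <= C * (1 - a) * l `^ q.
Proof.
move=> l00 T0 /andP[q0 q1]; pose B := q^-1 * (1 + (1 - q)^-1).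
have q1' : 0 < 1 - q by rewrite subr_gt0.
have B0 : 0 < B by rewrite mulr_gt0 ?invr_gt0// addr_gt0// invr_gt0.
pose D := (1 + T + T) / l0 `^ q.
have D0 : 0 < D by rewrite divr_gt0 ?powR_gt0// !addr_gt0.
exists ((D + B) *+ 2 + (q * l0 `^ q)^-1).
  by rewrite addr_gt0 ?invr_gt0 ?mulr_gt0 ?powR_gt0// pmulrn_lgt0// addr_gt0.
move=> a l a01 ll; have l1 := lt_le_trans l00 ll.
have /andP[a0 a1] := a01; have a1' : 0 < 1 - a by rewrite subr_gt0.
have lq : 1 <= l `^ q / l0 `^ q.
  rewrite ler_pdivlMr ?powR_gt0// mul1r.
  by apply: ge0_ler_powR; rewrite ?nnegrE ?(ltW q0) ?(ltW l00) ?(ltW l1).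
have p0 : 0 < (1 - a) * l `^ q by rewrite mulr_gt0// powR_gt0.
have [u hu] := gl_solutions a01 l1 T0.
have cu := cvg_gl_sol a01 l1 T0 hu.
have ce := cvg_euler l1 T0.
have cd : `|u n n - euler (l * (T / n%:R)) n| @[n --> \oo] -->
    `|mittag_leffler a (- (l * T `^ a)) - expR (- (l * T))|.
  exact: cvg_norm (cvgB cu ce).
suff H : \forall n \near \oo, `|u n n - euler (l * (T / n%:R)) n| <=
    ((D + B) *+ 2 + (q * l0 `^ q)^-1) * (1 - a) * l `^ q.
  rewrite -(cvg_lim _ cd)//; apply: limr_le => //.
  by apply/cvg_ex; eexists; exact: cd.
exists 1%N => // n /= n0; have N0 : 0 < n%:R :> R by rewrite ltr0n.
have h0 : 0 < T / n%:R by rewrite divr_gt0.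
have x0 : 0 < l * (T / n%:R) `^ a by rewrite mulr_gt0// powR_gt0.
have y0 : 0 < l * (T / n%:R) by rewrite mulr_gt0.
rewrite -mulrA mulrDl; have [aq|aq] := leP (1 - a) q; last first.
  apply: ler_wpDl; first by rewrite mulr_ge0 ?(ltW p0)// pmulrn_lge0// addr_ge0// ltW.
  apply: (@le_trans _ _ 1).
    have := gl_sol_ge0 a01 x0 (hu n n0) n; have := gl_sol_le1 a01 x0 (hu n n0) n.
    have := euler_ge0 y0 n; have := euler_le1 y0 n.
    by rewrite ler_norml; lra.
  rewrite invfM mulrACA -[leLHS]mulr1 ler_pM//.
    by rewrite mulrC ler_pdivlMr// mul1r ltW.
  by rewrite mulrC.
apply: ler_wpDr; first by rewrite mulr_ge0 ?(ltW p0)// invr_ge0 mulr_ge0 ?powR_ge0// ltW.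
have H := @euler_defect_le R (1 - a) q a1' aq q1 (T / n%:R) l (T + T) n h0 l1.
have aE : 1 - (1 - a) = a by ring.
rewrite aE in H.
have {}H := @gl_sol_euler R a _ _ a01 x0 y0 _ (hu n n0) _ n (H _).
apply: le_trans (H _ _ (leqnn n)) _.
  by rewrite -natr1 mulrDl mul1r mulrC divfK ?gt_eqF// lerD2l ler_pdivrMr// ler_peMr ?(ltW T0)// ler1n.
rewrite mulrnAl ler_wMn2r// (mulrC (D + B)) -[leRHS]mulrA ler_wpM2l ?(ltW a1')//.
rewrite addrA -/B mulrDr (mulrC _ B) lerD2r.
by rewrite /D mulrCA -[leLHS]mulr1 ler_wpM2l// !addr_ge0// ltW.
Qed.

End mittag_leffler_bounds.

(** * The Hilbert space [L^2(Omega)] *)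

Section L2_completeness.
Context d (T : measurableType d) (R : realType).
Variable mu : {measure set T -> \bar R}.

Lemma limn_einf_le_near (v : (\bar R)^nat) (c : \bar R) N :
  (forall k, (N <= k)%N -> (v k <= c)%E) -> (limn_einf v <= c)%E.
Proof.
move=> vc; rewrite limn_einf_lim; apply: lime_le; first exact: is_cvg_einfs.
apply: nearW => k; apply: le_trans (vc (maxn k N) (leq_maxr _ _)).
by apply: ereal_inf_lbound; exists (maxn k N) => //=; exact: leq_maxl.
Qed.

(* The subsequence converges almost everywhere since
   [|D k| <= 2 ^- k + 2 ^ k * (D k) ^ 2] for its increments [D k]. *)
Lemma cvg_rapidly_cauchy (s : nat -> R) :
  (\sum_(k <oo) (2 ^+ k * (s k.+1 - s k) ^+ 2)%:E < +oo)%E -> cvgn s.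
Proof.
move=> sy; pose D k := s k.+1 - s k.
have D0 k : 0 <= 2 ^+ k * D k ^+ 2 by rewrite mulr_ge0 ?sqr_ge0 ?exprn_ge0.
set M := (\sum_(k <oo) _)%E in sy.
have Mge k : (\sum_(0 <= i < k) (2 ^+ i * D i ^+ 2)%:E <= M)%E.
  by apply: nneseries_lim_ge => n _ _; rewrite lee_fin D0.
have M0 : (0 <= M)%E by have := Mge 0%N; rewrite big_geq.
have Mfin : M \is a fin_num by rewrite ge0_fin_numE.
have leD k : `|D k| <= (2^-1) ^+ k + 2 ^+ k * D k ^+ 2.
  rewrite -(real_normK (num_real (D k))) exprVn; set x := `|D k|.
  have p0 : 0 < 2 ^+ k :> R by rewrite exprn_gt0.
  have x0 : 0 <= x by rewrite normr_ge0.
  rewrite -(ler_pM2l p0) mulrDr divff ?gt_eqF//.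
  set p := 2 ^+ k in p0 *; have px : 0 <= p * x by rewrite mulr_ge0// ltW.
  rewrite (_ : p * (p * x ^+ 2) = (p * x) ^+ 2); last by ring.
  by set y := p * x in px *; nra.
have : cvgn (series D).
  apply: normed_cvg; apply: nondecreasing_is_cvgn.
    apply/nondecreasing_seqP => k.
    by rewrite (_ : [normed series D] k.+1 = `|D k| + [normed series D] k) ?lerDr//; exact: seriesS.
  exists (2 + fine M) => _ [k _ <-].
  rewrite /series /=.
  apply: (@le_trans _ _ (\sum_(0 <= i < k) ((2^-1) ^+ i + 2 ^+ i * D i ^+ 2))).
    by apply: ler_sum => i _; exact: leD.
  rewrite big_split /= lerD//.
    have -> : \sum_(0 <= i < k) (2^-1) ^+ i = 2 - 2 * (2^-1) ^+ k :> R.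
      elim: k => [|k IH]; first by rewrite big_geq// expr0; lra.
      by rewrite big_nat_recr//= IH exprS; field.
    by rewrite gerBl mulr_ge0// exprn_ge0.
  by rewrite -lee_fin fineK// -sumEFin.
have -> : series D = fun k => s k - s 0%N.
  by apply/funext => k; rewrite /series /= telescope_sumr.
move=> cD; have -> : s = fun k => (s k - s 0%N) + s 0%N.
  by apply/funext => k; rewrite subrK.
by apply: is_cvgD => //; exact: is_cvg_cst.
Qed.

(** Completeness of L^2: a rapidly Cauchy subsequence converges almost everywhere, and Fatou's lemma
    along it bounds the distance of every late term to the limit. *)
Lemma L2_limit_exists (S : (T -> R)^nat) :
  (forall k, measurable_fun [set: T] (S k)) ->
  (forall e : R, 0 < e -> exists N, forall m k, (N <= m)%N -> (N <= k)%N ->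
    (\int[mu]_x ((S m x - S k x) ^+ 2)%:E <= e%:E)%E) ->
  exists2 u : T -> R, measurable_fun [set: T] u &
    forall e : R, 0 < e -> exists N, forall m, (N <= m)%N ->
      (\int[mu]_x ((S m x - u x) ^+ 2)%:E <= e%:E)%E.
Proof.
move=> mS cS.
have /choice[f hf] : forall j, exists N, forall m k, (N <= m)%N -> (N <= k)%N ->
    (\int[mu]_x ((S m x - S k x) ^+ 2)%:E <= ((4 ^+ j)^-1)%:E)%E.
  by move=> j; apply: cS; rewrite invr_gt0 exprn_gt0.
(* The sum makes N k at least f j for all j <= k, and the summand j makes the indices unbounded. *)
pose N j := (\sum_(i < j.+1) f i + j)%N.
have fN j k : (j <= k)%N -> (f j <= N k)%N.
  move=> jk; rewrite /N (bigD1 (Ordinal (jk : (j < k.+1)%N)))//= -addnA; exact: leq_addr.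
have Nj j : (j <= N j)%N by rewrite /N leq_addl.
have msq k l : measurable_fun [set: T] (fun x => ((S k x - S l x) ^+ 2)%:E).
  apply/measurable_EFinP; apply: measurable_funX.
  by apply: measurable_funB; exact: mS.
pose g j x := (2 ^+ j * (S (N j.+1) x - S (N j) x) ^+ 2)%:E.
have g0 j x : (0 <= g j x)%E.
  by rewrite lee_fin mulr_ge0 ?sqr_ge0 ?exprn_ge0.
have mg j : measurable_fun [set: T] (g j).
  apply/measurable_EFinP; apply: measurable_funM; first exact: measurable_cst.
  by apply/measurable_EFinP; exact: msq.
have intg j : (\int[mu]_x g j x <= ((2^-1) ^+ j)%:E)%E.
  under eq_integral do rewrite /g EFinM.
  rewrite ge0_integralZl//; last first.
    by move=> x _; rewrite lee_fin sqr_ge0.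
  apply: (@le_trans _ _ ((2 ^+ j)%:E * ((4 ^+ j)^-1)%:E)%E).
    apply: lee_wpmul2l; first by rewrite lee_fin exprn_ge0.
    by apply: hf; exact: fN.
  rewrite -EFinM lee_fin -[4](_ : 2 * 2 = _); last by rewrite -natrM.
  by rewrite exprMn invfM mulrA divff ?mul1r ?exprVn// expf_neq0.
pose G x := (\sum_(j <oo) g j x)%E.
have mG : measurable_fun [set: T] G.
  exact: (ge0_emeasurable_sum (P := xpredT)).
have intG : mu.-integrable [set: T] G.
  apply/integrableP; split => //.
  under eq_integral do rewrite gee0_abs ?nneseries_ge0//.
  rewrite integral_nneseries//.
  apply: le_lt_trans (_ : \sum_(j <oo) ((2^-1) ^+ j)%:E < +oo)%E.
    by apply: lee_nneseries => // j _ _; exact: integral_ge0.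
  apply: le_lt_trans (_ : (2 : R)%:E < +oo)%E; last by rewrite ltry.
  apply: lime_le; first by apply: is_cvg_nneseries => k _ _; rewrite lee_fin exprn_ge0// invr_ge0.
  apply: nearW => k; rewrite sumEFin lee_fin.
  have -> : \sum_(0 <= i < k) (2^-1) ^+ i = 2 - 2 * (2^-1) ^+ k :> R.
    elim: k => [|k IH]; first by rewrite big_geq// expr0; lra.
    by rewrite big_nat_recr//= IH exprS; field.
  by rewrite gerBl mulr_ge0// exprn_ge0// invr_ge0.
have aeG := integrable_ae measurableT intG.
(* The upper limit is measurable and defined everywhere; it is the limit wherever the subsequence
   converges. *)
pose u x := fine (limn_esup (fun j => (S (N j) x)%:E)).
have mu_ : measurable_fun [set: T] u.
  apply: measurableT_comp => //; apply: measurable_fun_limn_esup => j.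
  exact/measurable_EFinP.
have aeu : {ae mu, forall x, S (N j) x @[j --> \oo] --> u x}.
  move: aeG; apply: filterS => x /(_ Logic.I) Gx.
  have cx : cvgn (fun j => S (N j) x).
    apply: cvg_rapidly_cauchy; rewrite -ge0_fin_numE// nneseries_ge0// => k _ _.
    exact: g0.
  have : (S (N j) x)%:E @[j --> \oo] --> (limn (fun j => S (N j) x))%:E.
    by apply: cvg_EFin => //; exact: nearW.
  by move=> /cvg_limn_einf_sup[_ E]; rewrite /u E.
exists u => // e e0.
have [M hM] := cS e e0.
exists M => m Mm.
pose F j x := ((S m x - S (N j) x) ^+ 2)%:E.
apply: (@le_trans _ _ (\int[mu]_x limn_einf (F ^~ x))%E).
  apply: ae_ge0_le_integral => //.
  - by move=> x _; rewrite lee_fin sqr_ge0.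
  - apply/measurable_EFinP; apply: measurable_funX.
    by apply: measurable_funB.
  - move=> x _; rewrite limn_einf_lim; apply: lime_ge; first exact: is_cvg_einfs.
    apply: nearW => k; apply: le_ereal_inf_tmp => _ [i _ <-].
    by rewrite lee_fin sqr_ge0.
  - have -> : (fun x => limn_einf (F ^~ x)) = (fun x => - limn_esup ((fun j x => - F j x) ^~ x))%E.
      by apply/funext.
    apply: measurableT_comp => //; apply: measurable_fun_limn_esup => j.
    by apply: measurableT_comp => //; exact: msq.
  - move: aeu; apply: filterS => x cx _.
    have : F j x @[j --> \oo] --> ((S m x - u x) ^+ 2)%:E.
      apply: cvg_EFin; first exact: nearW.
      apply: (@cvg_comp _ _ _ _ (fun t : R => t ^+ 2)); last exact: exprn_continuous.
      by apply: cvgB => //; exact: cvg_cst.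
    by move=> /cvg_limn_einf_sup[-> _].
have FT := @fatou _ _ _ mu [set: T] measurableT F (fun j => msq m (N j)).
apply: (le_trans (FT _)); first by move=> j x _; rewrite lee_fin sqr_ge0.
apply: (@limn_einf_le_near _ _ M) => k Mk.
by apply: hM => //; exact: leq_trans (Nj k).
Qed.

End L2_completeness.

Section L2_inner_product.
Context (R : realType) (n : nat) (Om : domain R n).
Local Notation mu := (dom_measure Om).
Local Notation dot := (L2dot Om).
Local Notation nrm := (L2norm Om).
Implicit Types f g h : 'rV[R]_n -> R.

Lemma L2P f : L2 Om f <->
  measurable_fun [set: 'rV[R]_n] f /\ (\int[mu]_x ((f x) ^+ 2)%:E < +oo)%E.
Proof.
split=> [Lf|[mf fy]].
  move: (Lf); rewrite /L2 => /Lfun2_integrable_sqr/integrableP[_ +].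
  move: Lf; rewrite /L2 inE => /andP[+ _]; rewrite inE/= => mf.
  move=> H; split => //; apply: le_lt_trans H.
  rewrite le_eqVlt; apply/orP; left; apply/eqP; apply: eq_integral => x _ /=.
  by rewrite ger0_norm ?sqr_ge0.
rewrite /L2 inE; apply/andP; split; rewrite inE//= /finite_norm unlock /Lnorm.
rewrite poweR_lty//; apply: le_lt_trans fy.
rewrite le_eqVlt; apply/orP; left; apply/eqP; apply: eq_integral => x _ /=.
by rewrite powR_mulrn ?normr_ge0// real_normK ?num_real.
Qed.

Let p1 : (1 <= 2%:E :> \bar R)%E.
Proof. by rewrite lee_fin ler1n. Qed.

Lemma L2_add f g : L2 Om f -> L2 Om g -> L2 Om (fun x => f x + g x).
Proof. exact: (Lfun_addr_closed mu p1).2. Qed.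

Lemma L2_scale c f : L2 Om f -> L2 Om (fun x => c * f x).
Proof.
move=> Lf; rewrite (_ : (fun _ => _) = c \o* f); last first.
  by apply/funext => x /=; rewrite mulrC.
by apply: Lfun_scale => //; rewrite ler1n.
Qed.

Lemma L2_opp f : L2 Om f -> L2 Om (fun x => - f x).
Proof.
move=> Lf; rewrite (_ : (fun _ => _) = fun x => -1 * f x); first exact: L2_scale.
by apply/funext => x; rewrite mulN1r.
Qed.

Lemma L2_sub f g : L2 Om f -> L2 Om g -> L2 Om (fun x => f x - g x).
Proof. by move=> Lf Lg; apply: L2_add => //; exact: L2_opp. Qed.

Lemma L2_cst0 : L2 Om (cst 0).
Proof. exact: (Lfun_addr_closed mu p1).1. Qed.

Lemma L2_sum N (F : nat -> 'rV[R]_n -> R) : (forall k, L2 Om (F k)) ->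
  L2 Om (fun x => \sum_(k < N) F k x).
Proof.
move=> LF; elim: N => [|N IH].
  by under eq_fun do rewrite big_ord0; exact: L2_cst0.
by under eq_fun do rewrite big_ord_recr; exact: L2_add.
Qed.

Lemma L2_integrable_mul f g : L2 Om f -> L2 Om g ->
  mu.-integrable [set: _] (EFin \o (fun x => f x * g x)).
Proof. by move=> Lf Lg; apply/Lfun1_integrable; exact: Lfun2_mul_Lfun1. Qed.

Lemma L2dotC f g : dot f g = dot g f.
Proof. by apply: eq_Rintegral => x _; rewrite mulrC. Qed.

Lemma L2dotDl f g h : L2 Om f -> L2 Om g -> L2 Om h ->
  dot (fun x => f x + g x) h = dot f h + dot g h.
Proof.
move=> Lf Lg Lh; rewrite -RintegralD ?L2_integrable_mul//.
by apply: eq_Rintegral => x _; rewrite mulrDl.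
Qed.

Lemma L2dotZl c f h : L2 Om f -> L2 Om h -> dot (fun x => c * f x) h = c * dot f h.
Proof.
move=> Lf Lh; rewrite -RintegralZl ?L2_integrable_mul//.
by apply: eq_Rintegral => x _; rewrite mulrA.
Qed.

Lemma L2dotBl f g h : L2 Om f -> L2 Om g -> L2 Om h ->
  dot (fun x => f x - g x) h = dot f h - dot g h.
Proof.
move=> Lf Lg Lh; rewrite -RintegralB ?L2_integrable_mul//.
by apply: eq_Rintegral => x _; rewrite mulrBl.
Qed.

Lemma L2dot0l h : dot (cst 0) h = 0.
Proof.
rewrite /L2dot; under eq_Rintegral do rewrite mul0r.
by rewrite Rintegral_cst// mul0r.
Qed.

Lemma L2dot_suml N (F : nat -> 'rV[R]_n -> R) h : (forall k, L2 Om (F k)) -> L2 Om h ->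
  dot (fun x => \sum_(k < N) F k x) h = \sum_(k < N) dot (F k) h.
Proof.
move=> LF Lh; elim: N => [|N IH].
  by under eq_fun do rewrite big_ord0; rewrite big_ord0; exact: L2dot0l.
under eq_fun do rewrite big_ord_recr; rewrite big_ord_recr -IH.
by apply: L2dotDl => //; exact: L2_sum.
Qed.

Lemma L2norm_ge0 f : 0 <= nrm f.
Proof. by rewrite fine_ge0// Lnorm_ge0. Qed.

(** Membership in [L2] is not assumed: when the norm is infinite, [fine] sends both sides to 0. *)
Lemma L2norm_sqr f : nrm f ^+ 2 = dot f f.
Proof.
have := @powR_Lnorm _ _ _ mu (EFin \o f) 2; rewrite pnatr_eq0 => /(_ erefl) H.
rewrite /L2dot /Rintegral.
have -> : (\int[mu]_x (f x * f x)%:E = \int[mu]_x (`|(EFin \o f) x| `^ 2))%E.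
  apply: eq_integral => x _ /=.
  by rewrite -expr2 powR_mulrn ?normr_ge0// real_normK ?num_real.
rewrite -H /L2norm; set N := Lnorm _ _ _; have : (0 <= N)%E by exact: Lnorm_ge0.
case: N => [r| |]// r0; first by rewrite /= powR_mulrn.
rewrite poweRyr ?pnatr_eq0//.
by rewrite /= expr0n.
Qed.

Lemma L2dot_ge0 f : 0 <= dot f f.
Proof. by rewrite -L2norm_sqr sqr_ge0. Qed.

Lemma L2dot_add_sqr f g : L2 Om f -> L2 Om g ->
  dot (fun x => f x + g x) (fun x => f x + g x) = dot f f + 2 * dot f g + dot g g.
Proof.
move=> Lf Lg; have Lfg := L2_add Lf Lg.
rewrite L2dotDl// (L2dotC f) (L2dotC g) !L2dotDl// (L2dotC g f); ring.
Qed.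

Lemma L2dot_CauchySchwarz f g : L2 Om f -> L2 Om g -> `|dot f g| <= nrm f * nrm g.
Proof.
move=> Lf Lg.
rewrite -(@ler_pXn2r _ 2)// ?nnegrE ?mulr_ge0 ?L2norm_ge0//.
rewrite real_normK ?num_real// exprMn !L2norm_sqr.
have H t : 0 <= dot f f + 2 * (t * dot f g) + t ^+ 2 * dot g g.
  have := L2dot_ge0 (fun x => f x + t * g x).
  rewrite L2dot_add_sqr//; last exact: L2_scale.
  have Lt := L2_scale t Lg.
  rewrite (L2dotC f) !L2dotZl//.
  by rewrite (L2dotC g (fun x => t * g x)) L2dotZl// (L2dotC g f) expr2 -mulrA.
have := L2dot_ge0 g; rewrite le_eqVlt => /predU1P[g0|g0].
  rewrite -g0 mulr0; have [->|B0] := eqVneq (dot f g) 0; first by rewrite expr0n.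
  (* When g has norm zero the polynomial in t is affine; this t gives it the value -1. *)
  have := H (- (dot f f + 1) / (2 * dot f g)); rewrite -g0 mulr0 addr0.
  have -> : 2 * (- (dot f f + 1) / (2 * dot f g) * dot f g) = - (dot f f + 1) by field.
  by lra.
have := H (- dot f g / dot g g).
have -> : dot f f + 2 * (- dot f g / dot g g * dot f g) + (- dot f g / dot g g) ^+ 2 * dot g g
   = dot f f - dot f g ^+ 2 / dot g g by field; rewrite gt_eqF.
by rewrite subr_ge0 ler_pdivrMr.
Qed.

End L2_inner_product.

(** * Orthonormal expansions and spectral multipliers *)

Section orthonormal_basis.
Context (R : realType) (n : nat) (Om : domain R n) (phi : nat -> 'rV[R]_n -> R).
Local Notation dot := (L2dot Om).
Local Notation nrm := (L2norm Om).
Hypothesis phiL2 : forall k, L2 Om (phi k).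
Hypothesis phi_ortho : forall i j, dot (phi i) (phi j) = (i == j)%:R.
Hypothesis phi_basis : forall f, L2 Om f ->
  nrm ((fun x => \sum_(k < N) dot f (phi k) * phi k x) \- f) @[N --> \oo] --> 0.
Implicit Types (f g : 'rV[R]_n -> R) (a : nat -> R).

Definition fourier_sum a N x : R := \sum_(k < N) a k * phi k x.

Lemma L2_fourier_sum a N : L2 Om (fourier_sum a N).
Proof. by apply: (@L2_sum _ _ _ N (fun k x => a k * phi k x)) => k; exact: L2_scale. Qed.

Lemma dot_fourier_suml a N g : L2 Om g ->
  dot (fourier_sum a N) g = \sum_(k < N) a k * dot (phi k) g.
Proof.
move=> Lg; rewrite (@L2dot_suml _ _ _ N (fun k x => a k * phi k x))//; last first.
  by move=> k; exact: L2_scale.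
by apply: eq_bigr => k _; rewrite L2dotZl.
Qed.

Lemma coef_fourier_sum a N j : dot (fourier_sum a N) (phi j) = a j *+ (j < N)%N.
Proof.
rewrite dot_fourier_suml//; under eq_bigr do rewrite phi_ortho.
have [jN|Nj] := ltnP j N.
  rewrite (bigD1 (Ordinal jN))//= eqxx mulr1 big1 ?addr0// => i ij.
  by rewrite (negbTE (_ : nat_of_ord i != j)) ?mulr0//; apply: contraNneq ij => ij; apply/eqP/val_inj.
rewrite big1// => i _; rewrite ltn_eqF ?mulr0//.
exact: leq_trans (ltn_ord i) Nj.
Qed.

Lemma norm_fourier_sum a N : dot (fourier_sum a N) (fourier_sum a N) = \sum_(k < N) a k ^+ 2.
Proof.
rewrite dot_fourier_suml; last exact: L2_fourier_sum.
by apply: eq_bigr => k _; rewrite L2dotC coef_fourier_sum ltn_ord mulr1n expr2.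
Qed.

Lemma norm_fourier_sumB f a N : L2 Om f ->
  nrm (fourier_sum a N \- f) ^+ 2 =
  \sum_(k < N) a k ^+ 2 - 2 * \sum_(k < N) a k * dot f (phi k) + nrm f ^+ 2.
Proof.
move=> Lf; have LS := L2_fourier_sum a N.
have LD : L2 Om (fourier_sum a N \- f) by exact: L2_sub.
rewrite !L2norm_sqr L2dotBl// (L2dotC Om (fourier_sum a N)) (L2dotC Om f) !L2dotBl//.
rewrite norm_fourier_sum (L2dotC Om f) dot_fourier_suml//.
under [X in _ - X - _]eq_bigr do rewrite L2dotC.
under [X in _ - (X - _)]eq_bigr do rewrite L2dotC.
by ring.
Qed.

Lemma norm_sqr_split f N : L2 Om f ->
  nrm f ^+ 2 = \sum_(k < N) dot f (phi k) ^+ 2 +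
    nrm (fourier_sum (fun k => dot f (phi k)) N \- f) ^+ 2.
Proof.
move=> Lf; rewrite norm_fourier_sumB//.
by under [X in 2 * X]eq_bigr do rewrite -expr2; ring.
Qed.

Lemma bessel f N : L2 Om f -> \sum_(k < N) dot f (phi k) ^+ 2 <= nrm f ^+ 2.
Proof. by move=> Lf; rewrite (norm_sqr_split N Lf) lerDl sqr_ge0. Qed.

Lemma coef_norm_le f k : L2 Om f -> `|dot f (phi k)| <= nrm f.
Proof.
move=> Lf; apply: le_trans (L2dot_CauchySchwarz Lf (phiL2 k)) _.
rewrite ler_piMr ?L2norm_ge0// -(@ler_pXn2r _ 2)// ?nnegrE ?L2norm_ge0//.
by rewrite L2norm_sqr phi_ortho eqxx expr1n.
Qed.

Lemma parseval_le f B : L2 Om f ->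
  (forall N, \sum_(k < N) dot f (phi k) ^+ 2 <= B) -> nrm f ^+ 2 <= B.
Proof.
move=> Lf H; apply/ler_addgt0Pr => e e0.
have se : 0 < Num.sqrt e by rewrite sqrtr_gt0.
have /cvgrPdist_lt/(_ _ se)[N _ /(_ N (leqnn N))] := phi_basis Lf.
rewrite /= sub0r normrN ger0_norm ?L2norm_ge0// => lt.
rewrite (norm_sqr_split N Lf) lerD// -[leRHS](sqr_sqrtr (ltW e0)).
by rewrite lerXn2r ?nnegrE ?L2norm_ge0 ?sqrtr_ge0// ltW.
Qed.

Lemma coef_limit a u k : L2 Om u -> nrm (fourier_sum a N \- u) @[N --> \oo] --> 0 ->
  dot u (phi k) = a k.
Proof.
move=> Lu cu; apply/eqP; rewrite eq_sym -subr_eq0 -normr_le0.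
apply/ler_addgt0Pr => e e0; rewrite add0r.
have /cvgrPdist_lt/(_ _ e0)[N _ HN] := cu.
have := HN (maxn N k.+1) (leq_maxl _ _).
rewrite /= sub0r normrN ger0_norm ?L2norm_ge0// => /ltW; apply: le_trans.
have LS := L2_fourier_sum a (maxn N k.+1).
apply: le_trans (coef_norm_le k (L2_sub LS Lu)).
by rewrite L2dotBl// coef_fourier_sum leq_maxr mulr1n.
Qed.

Lemma riesz_fischer a B : (forall N, \sum_(k < N) a k ^+ 2 <= B) ->
  exists u, L2 Om u /\ nrm (fourier_sum a N \- u) @[N --> \oo] --> 0.
Proof.
move=> aB; pose S N := \sum_(k < N) a k ^+ 2.
have Smono : nondecreasing_seq S.
  by apply/nondecreasing_seqP => k; rewrite /S big_ord_recr lerDl sqr_ge0.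
have cS : cvgn S.
  by apply: nondecreasing_is_cvgn => //; exists B => _ [k _ <-]; exact: aB.
have sumB N M : (N <= M)%N ->
    dot (fourier_sum a M \- fourier_sum a N) (fourier_sum a M \- fourier_sum a N) = S M - S N.
  move=> NM; have LM := L2_fourier_sum a M; have LN := L2_fourier_sum a N.
  rewrite -L2norm_sqr norm_fourier_sumB// L2norm_sqr norm_fourier_sum.
  have -> : \sum_(k < M) a k * dot (fourier_sum a N) (phi k) = S N.
    rewrite /S (big_ord_widen M (fun k => a k ^+ 2) NM) [RHS]big_mkcond.
    apply: eq_bigr => k _; rewrite coef_fourier_sum.
    by case: ifP => _; rewrite ?mulr0// mulr1n expr2.
  by rewrite /S; ring.
have intE f g : L2 Om f -> L2 Om g ->
    (\int[dom_measure Om]_x ((f x - g x) ^+ 2)%:E = (dot (f \- g) (f \- g))%:E)%E.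
  move=> Lf Lg; rewrite /L2dot /Rintegral fineK; last first.
    by apply: integrable_fin_num => //; apply: L2_integrable_mul; exact: L2_sub.
  by apply: eq_integral => x _; rewrite expr2.
have mS k : measurable_fun [set: 'rV[R]_n] (fourier_sum a k).
  by have /L2P[] := L2_fourier_sum a k.
have [e e0|u mu_ hu] := @L2_limit_exists _ _ _ (dom_measure Om) (fourier_sum a) mS.
  have e2 : 0 < e / 2 by rewrite divr_gt0.
  have /cvgrPdist_lt/(_ _ e2)[N _ HN] := cS.
  exists N => m k Nm Nk; wlog km : m k Nm Nk / (k <= m)%N.
    move=> W; have [km|mk] := leqP k m; first exact: W.
    rewrite (_ : (fun x => _) = (fun x => ((fourier_sum a k x - fourier_sum a m x) ^+ 2)%:E)).
      by apply: W => //; exact: ltnW.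
    by apply/funext => x; rewrite -sqrrN opprB.
  rewrite intE ?sumB//; try exact: L2_fourier_sum.
  have := HN m Nm; have := HN k Nk; rewrite /= !ltr_norml lee_fin.
  by move=> /andP[? ?] /andP[? ?]; lra.
have Lu : L2 Om u.
  have [N /(_ N (leqnn N)) H1] := hu 1 ltr01.
  rewrite (_ : u = fun x => fourier_sum a N x - (fourier_sum a N x - u x)).
    apply: L2_sub; first exact: L2_fourier_sum.
    apply/L2P; split; first exact: measurable_funB.
    by apply: le_lt_trans H1 _; rewrite ltry.
  by apply/funext => x; rewrite subKr.
exists u; split => //; apply/cvgrPdist_lt => e e0.
have e2 : 0 < e / 2 by rewrite divr_gt0.
have [N HN] := hu _ (exprn_gt0 2 e2); exists N => // m /= Nm.
rewrite sub0r normrN ger0_norm ?L2norm_ge0//.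
apply: le_lt_trans (_ : e / 2 < e); last lra.
rewrite -(@ler_pXn2r _ 2)// ?nnegrE ?L2norm_ge0 ?(ltW e2)//.
have := HN m Nm; rewrite intE//; last exact: L2_fourier_sum.
by rewrite lee_fin L2norm_sqr.
Qed.

Section spectral_calculus.
Variables (lam : nat -> R) (m : R -> R).

(** The second alternative is the default value of a divergent series. It cannot be excluded for a
    multiplier that may be unbounded, such as the inverse Mittag-Leffler values. *)
Lemma spectral_spec f : L2 Om f ->
  L2 Om (spectral Om lam phi m f) /\
  ((forall k, dot (spectral Om lam phi m f) (phi k) = m (lam k) * dot f (phi k)) \/
   spectral Om lam phi m f = cst 0).
Proof.
move=> Lf; rewrite /spectral; case: xgetP => [u _ [Lu cu]|_]; last first.
  by split; [exact: L2_cst0|right].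
split => //; left => k.
exact: (@coef_limit (fun k => m (lam k) * dot f (phi k)) u k Lu cu).
Qed.

(** A bounded multiplier keeps the coefficients square summable by Bessel's inequality, so the
    series has a sum and the default value does not occur. *)
Lemma coef_spectral M f : (forall k, `|m (lam k)| <= M) -> L2 Om f -> forall k,
  dot (spectral Om lam phi m f) (phi k) = m (lam k) * dot f (phi k).
Proof.
move=> mM Lf k; have [|u [Lu cu]] :=
    @riesz_fischer (fun k => m (lam k) * dot f (phi k)) (M ^+ 2 * nrm f ^+ 2).
  move=> N; apply: le_trans (ler_wpM2l (sqr_ge0 _) (bessel N Lf)).
  rewrite mulr_sumr; apply: ler_sum => i _; rewrite exprMn ler_wpM2r ?sqr_ge0//.
  by rewrite -(real_normK (num_real (m _))) lerXn2r ?nnegrE// (le_trans _ (mM i)).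
rewrite /spectral; case: xgetP => [v _ [Lv cv]|/(_ u)]; last by case; split.
exact: (@coef_limit (fun k => m (lam k) * dot f (phi k)) v k Lv cv).
Qed.

End spectral_calculus.

End orthonormal_basis.

(** * Regularization estimates *)

Section coefficient_estimates.
Variable R : realType.
Implicit Types (x y l : R).

Lemma powR_le_powR_scaled l0 l x y : 0 < l0 -> l0 <= l -> x <= y ->
  l `^ x <= l0 `^ (x - y) * l `^ y.
Proof.
move=> l00 ll xy; have l1 := lt_le_trans l00 ll.
have -> : l `^ x = l `^ (x - y) * l `^ y.
  by rewrite -powRD ?subrK//; apply/implyP => _; rewrite gt_eqF.
rewrite ler_wpM2r ?powR_ge0// -[x - y]opprB !powRN lef_pV2 ?posrE ?powR_gt0//.
by apply: ge0_ler_powR; rewrite ?nnegrE ?subr_ge0 ?(ltW l00) ?(ltW l1).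
Qed.

(** The spectral filter of i Landweber steps from 0, with x = mu l ^ (- 2 s). *)
Definition landweber_factor x i : R := 1 - (1 - x) ^+ i.

Lemma landweber_factor_ge0 x i : 0 <= x <= 1 -> 0 <= landweber_factor x i.
Proof.
by move=> /andP[x0 x1]; rewrite subr_ge0 exprn_ile1 ?subr_ge0// gerBl.
Qed.

Lemma landweber_factor_le1 x i : 0 <= x <= 1 -> landweber_factor x i <= 1.
Proof. by move=> /andP[x0 x1]; rewrite gerBl exprn_ge0// subr_ge0. Qed.

Lemma landweber_factor_le x i : 0 <= x <= 1 -> landweber_factor x i <= i%:R * x.
Proof.
move=> x01; rewrite /landweber_factor; elim: i => [|i IH].
  by rewrite expr0 subrr mul0r.
have := landweber_factor_le1 i x01; have := landweber_factor_ge0 i x01.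
rewrite /landweber_factor exprS -natr1; case/andP: x01 => x0 x1.
move: IH; set P := (1 - x) ^+ i; move: P; set I := i%:R; move: I => I P.
nra.
Qed.

(** Interpolation between the bounds 1 and i x. A suitable t lets the filter absorb a prescribed
    power of l at the price i ^ t. *)
Lemma landweber_factor_le_powR x i t : 0 <= x <= 1 -> 0 <= t <= 1 ->
  landweber_factor x i <= (i%:R * x) `^ t.
Proof.
move=> x01 t01; have /andP[x0 x1] := x01; have /andP[t0 t1] := t01.
have ix0 : 0 <= i%:R * x by rewrite mulr_ge0.
have [le1|gt1] := leP (i%:R * x) 1; last first.
  apply: le_trans (landweber_factor_le1 i x01) _.
  by rewrite -[leLHS](@powRr0 _ (i%:R * x)) ler_powR ?(ltW gt1).
apply: le_trans (landweber_factor_le i x01) _.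
move: ix0; rewrite le_eqVlt => /predU1P[<-|ix0]; first exact: powR_ge0.
by rewrite ger1_powR// ix0.
Qed.

(** Gives (1 - x) ^ i <= 1 / (1 + i x), an explicit rate at which the filter tends to 1 for fixed x
    > 0. *)
Lemma landweber_defect_le x i : 0 <= x <= 1 ->
  (1 - landweber_factor x i) * (1 + i%:R * x) <= 1.
Proof.
move=> /andP[x0 x1]; rewrite /landweber_factor subKr.
elim: i => [|i IH]; first by rewrite expr0 mul0r addr0 mulr1.
have P0 : 0 <= (1 - x) ^+ i by rewrite exprn_ge0// subr_ge0.
rewrite exprS -natr1; move: IH P0.
have I0 : 0 <= i%:R :> R by [].
move: I0; set P := (1 - x) ^+ i; move: P; set I := i%:R; move: I => I P I0 IH P0.
apply: le_trans IH; rewrite -subr_ge0.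
have -> : P * (1 + I * x) - (1 - x) * P * (1 + (I + 1) * x) = P * ((I + 1) * x ^+ 2) by ring.
by rewrite mulr_ge0// mulr_ge0 ?sqr_ge0// addr_ge0.
Qed.

(* [Ea] stands for the Mittag-Leffler value, [ex] for the exponential it
   approximates and [eps] for [1 - alpha]. *)
Lemma backward_coef_bounds (l0 q CA CE : R) : 0 < l0 -> 0 < q -> 0 < CA -> 0 < CE ->
  exists2 K, 0 < K & forall l eps Ea ex rho M u eta : R,
    l0 <= l -> 0 < eps -> 0 < Ea -> 0 < ex <= 1 -> 0 <= rho <= 1 ->
    Ea^-1 <= CA * l / eps -> `|Ea - ex| <= CE * eps * l `^ q ->
    rho * l `^ (1 + q) <= M ->
    `|Ea^-1 * (rho * (ex * u + eta))| <=
      K * (l `^ (1 + 4 * q) * `|u| + M / eps * `|eta|) /\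
    `|ex * (Ea^-1 * (rho * (ex * u + eta))) - rho * (ex * u + eta)| <=
      K * (eps * (l `^ (1 + 4 * q) * `|u|) + M * `|eta|).
Proof.
move=> l00 q0 CA0 CE0; pose G := CA * CE.
have G0 : 0 < G by rewrite mulr_gt0.
pose c x := l0 `^ (x - (1 + 4 * q)).
have c0 x : 0 < c x by rewrite powR_gt0.
pose c5 := l0 `^ (1 - (1 + q)); have c50 : 0 < c5 by rewrite powR_gt0.
pose K1 := c 0 + G * c (1 + q); pose K2 := CA * c5.
pose K3 := CE * (c q + G * c (1 + 2 * q)).
have K10 : 0 < K1 by rewrite addr_gt0// mulr_gt0.
have K20 : 0 < K2 by rewrite mulr_gt0.
have K30 : 0 < K3 by rewrite mulr_gt0// addr_gt0// mulr_gt0.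
exists (K1 + K2 + K3 + G); first by do 2 (apply: addr_gt0 => //); apply: addr_gt0.
move=> l eps Ea ex rho M u eta ll eps0 Ea0 /andP[ex0 ex1] /andP[r0 r1] hA hC hM.
have l1 := lt_le_trans l00 ll.
have M0 : 0 <= M by apply: le_trans hM; rewrite mulr_ge0 ?powR_ge0.
have Ei0 : 0 < Ea^-1 by rewrite invr_gt0.
set X := l `^ (1 + 4 * q); have X0 : 0 < X by rewrite powR_gt0.
have cX x : x <= 1 + 4 * q -> l `^ x <= c x * X by exact: powR_le_powR_scaled.
(* The eps of the approximation error cancels the 1 / eps of the amplification. *)
have f0 : `|Ea - ex| * Ea^-1 <= G * l `^ (1 + q).
  apply: (@le_trans _ _ (CE * eps * l `^ q * (CA * l / eps))).
    by rewrite ler_pM// ltW.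
  rewrite powRD; last by apply/implyP => _; rewrite gt_eqF.
  rewrite powRr1 ?(ltW l1)// le_eqVlt; apply/orP; left; apply/eqP.
  by rewrite /G; field; rewrite gt_eqF.
have f1 : ex * Ea^-1 <= 1 + G * l `^ (1 + q).
  have -> : ex * Ea^-1 = 1 - (Ea - ex) * Ea^-1 by rewrite mulrBl divff ?gt_eqF//; ring.
  rewrite lerD2l; apply: le_trans f0; rewrite -mulNr ler_wpM2r ?(ltW Ei0)//.
  by rewrite -normrN ler_norm.
have f1X : ex * Ea^-1 <= K1 * X.
  apply: le_trans f1 _; rewrite mulrDl -mulrA lerD ?ler_wpM2l ?(ltW G0) ?cX//; last lra.
  by rewrite -[leLHS](@powRr0 _ l) cX//; lra.
have f2 : rho * Ea^-1 <= K2 * (M / eps).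
  apply: (@le_trans _ _ (rho * (CA * l / eps))); first by rewrite ler_wpM2l.
  apply: (@le_trans _ _ (CA / eps * c5 * (rho * l `^ (1 + q)))).
    have -> : rho * (CA * l / eps) = CA / eps * rho * l by ring.
    have -> : CA / eps * c5 * (rho * l `^ (1 + q)) = CA / eps * rho * (c5 * l `^ (1 + q)) by ring.
    rewrite ler_wpM2l//; first by rewrite !mulr_ge0 ?invr_ge0 ?(ltW CA0) ?(ltW eps0).
    by rewrite -[leLHS]powRr1 ?(ltW l1)// powR_le_powR_scaled//; lra.
  have -> : K2 * (M / eps) = CA / eps * c5 * M by rewrite /K2; ring.
  by rewrite ler_wpM2l// !mulr_ge0 ?invr_ge0 ?(ltW CA0) ?(ltW eps0) ?(ltW c50).
(* On exact data the datum carries a factor [ex], and ex / Ea is bounded independently of eps by f1;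
   hence one factor eps survives here. *)
have f3 : `|Ea - ex| * (ex * Ea^-1) <= eps * (K3 * X).
  apply: (@le_trans _ _ (CE * eps * l `^ q * (1 + G * l `^ (1 + q)))).
    by rewrite ler_pM// mulr_ge0// ltW.
  have -> : CE * eps * l `^ q * (1 + G * l `^ (1 + q)) =
      eps * (CE * (l `^ q + G * l `^ (1 + 2 * q))).
    have -> : l `^ (1 + 2 * q) = l `^ q * l `^ (1 + q).
      rewrite -powRD; last by apply/implyP => _; rewrite gt_eqF.
      by congr (_ `^ _); ring.
    by ring.
  rewrite ler_wpM2l ?(ltW eps0)// /K3 -mulrA ler_wpM2l ?(ltW CE0)// [leRHS]mulrDl.
  by rewrite -mulrA lerD ?ler_wpM2l ?(ltW G0) ?cX//; lra.
have f4 : `|Ea - ex| * Ea^-1 * rho <= G * M.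
  apply: (@le_trans _ _ (G * l `^ (1 + q) * rho)); first by rewrite ler_wpM2r.
  by rewrite -mulrA (mulrC _ rho) ler_wpM2l ?(ltW G0).
have u0 := normr_ge0 u; have e0 := normr_ge0 eta.
have KX0 : 0 <= X * `|u| by rewrite mulr_ge0// ltW.
have KM0 : 0 <= M / eps * `|eta| by rewrite mulr_ge0// divr_ge0// ltW.
split.
  have -> : Ea^-1 * (rho * (ex * u + eta)) = rho * (ex * Ea^-1 * u) + rho * Ea^-1 * eta by ring.
  apply: le_trans (ler_normD _ _) _; rewrite !normrM (ger0_norm r0).
  rewrite (gtr0_norm ex0) (gtr0_norm Ei0).
  apply: (@le_trans _ _ (K1 * (X * `|u|) + K2 * (M / eps * `|eta|))).
    apply: lerD; last by rewrite mulrA ler_wpM2r.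
    apply: (@le_trans _ _ (1 * (ex * Ea^-1 * `|u|))).
      by rewrite ler_wpM2r// !mulr_ge0// ltW.
    by rewrite mul1r mulrA ler_wpM2r.
  rewrite mulrDr; apply: lerD; rewrite ler_wpM2r//; lra.
have -> : ex * (Ea^-1 * (rho * (ex * u + eta))) - rho * (ex * u + eta) =
    rho * (- (Ea - ex) * (ex * Ea^-1) * u) + - (Ea - ex) * Ea^-1 * rho * eta.
  by field; rewrite gt_eqF.
apply: le_trans (ler_normD _ _) _; rewrite !normrM normrN (ger0_norm r0).
rewrite (gtr0_norm ex0) (gtr0_norm Ei0).
have m0 : 0 <= `|Ea - ex| * (ex * Ea^-1) * `|u| by rewrite !mulr_ge0// ltW.
apply: (@le_trans _ _ (K3 * (eps * (X * `|u|)) + G * (M * `|eta|))).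
  apply: lerD; last by rewrite [leRHS]mulrA ler_wpM2r.
  apply: (@le_trans _ _ (1 * (`|Ea - ex| * (ex * Ea^-1) * `|u|))).
    by rewrite ler_wpM2r.
  rewrite mul1r (_ : K3 * _ = eps * (K3 * X) * `|u|); last by ring.
  by rewrite ler_wpM2r.
have KX0' : 0 <= eps * (X * `|u|) by rewrite mulr_ge0// ltW.
have KM0' : 0 <= M * `|eta| by rewrite mulr_ge0.
rewrite mulrDr; apply: lerD; rewrite ler_wpM2r//; lra.
Qed.

Lemma near0_ln_ge (U B : R) : 0 < U -> \forall d \near 0^'+, B <= ln (U / d).
Proof.
move=> U0; have b0 : 0 < U * expR (- B) by rewrite mulr_gt0// expR_gt0.
near=> d.
have d0 : 0 < d by near: d; exact: nbhs_right_gt.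
have db : d < U * expR (- B) by near: d; exact: nbhs_right_lt.
rewrite -ler_expR lnK ?posrE ?divr_gt0// ler_pdivlMr// -ler_pdivlMl ?expR_gt0//.
by rewrite -expRN mulrC ltW.
Unshelve. all: by end_near. Qed.

(** Applied with t = 2 theta and L the logarithm: the squared noise amplification grows like L ^ t,
    which the factor L in the square of [td] dominates. *)
Lemma near0_ln_absorb (A B c t : R) : 0 < A -> 0 < B -> 0 < c -> t < 1 ->
  exists L0, forall L, L0 <= L -> 0 < L -> B * (A * L) `^ t <= c * L.
Proof.
move=> A0 B0 c0 t1; have t1' : 0 < 1 - t by rewrite subr_gt0.
exists ((B * A / c) `^ (1 - t)^-1 / A) => L LL L0.
have AL0 : 0 < A * L by rewrite mulr_gt0.
have D0 : 0 < B * A / c by rewrite divr_gt0// mulr_gt0.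
have h : B * A / c <= (A * L) `^ (1 - t).
  have -> : B * A / c = ((B * A / c) `^ (1 - t)^-1) `^ (1 - t).
    by rewrite -powRrM mulVf ?gt_eqF// powRr1// ltW.
  apply: ge0_ler_powR; rewrite ?nnegrE ?powR_ge0 ?(ltW t1') ?(ltW AL0)//.
  by rewrite (mulrC A) -ler_pdivrMr.
have e : A * L = (A * L) `^ t * (A * L) `^ (1 - t).
  rewrite -powRD; last by apply/implyP => _; rewrite gt_eqF.
  by rewrite addrC subrK powRr1// ltW.
have p0 : 0 < (A * L) `^ t by rewrite powR_gt0.
have : (A * L) `^ t * (B * A / c) <= A * L by rewrite {2}e ler_wpM2l// ltW.
rewrite -(@ler_pM2l _ (c / A)) ?divr_gt0//.
have -> : c / A * ((A * L) `^ t * (B * A / c)) = B * (A * L) `^ t.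
  by field; rewrite !gt_eqF.
by have -> : c / A * (A * L) = c * L by field; rewrite gt_eqF.
Qed.

End coefficient_estimates.

Section weak_convergence.
Context (R : realType) (n : nat) (Om : domain R n) (phi : nat -> 'rV[R]_n -> R).
Local Notation dot := (L2dot Om).
Local Notation nrm := (L2norm Om).
Hypothesis phiL2 : forall k, L2 Om (phi k).
Hypothesis phi_basis : forall f, L2 Om f ->
  nrm ((fun x => \sum_(k < N) dot f (phi k) * phi k x) \- f) @[N --> \oo] --> 0.

(** Approximate the test function by a finite Fourier sum: coefficients handle the sum, the norm
    bound handles the tail. *)
Lemma weakly_cvg_coef (F : set_system R) (FF : Filter F) (v : R -> 'rV[R]_n -> R) u B :
  L2 Om u ->
  (\forall d \near F, L2 Om (v d) /\ nrm (v d) <= B) ->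
  (forall k, dot (v d) (phi k) @[d --> F] --> dot u (phi k)) ->
  weakly_cvg Om F v u.
Proof.
move=> Lu vB vu; split; first by apply: filterS vB => d [].
move=> psi Lpsi; apply/cvgrPdist_lt => e e0.
have C0 : 0 < `|B| + nrm u + 1 by rewrite ltr_wpDl// addr_ge0 ?L2norm_ge0.
have e2 : 0 < e / 2 / (`|B| + nrm u + 1) by rewrite !divr_gt0.
have /cvgrPdist_lt/(_ _ e2)[N _ /(_ N (leqnn N))] := phi_basis Lpsi.
set P := (X in nrm (X \- _)).
have PE : P = fourier_sum phi (fun k => dot psi (phi k)) N by [].
have LP : L2 Om P by rewrite PE; exact: L2_fourier_sum.
rewrite /= sub0r normrN ger0_norm ?L2norm_ge0// => Pe.
have cP : dot (v d) P @[d --> F] --> dot u P.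
  have dP f : L2 Om f -> dot f P = \sum_(k < N) dot psi (phi k) * dot f (phi k).
    move=> Lf; rewrite L2dotC PE dot_fourier_suml//.
    by apply: eq_bigr => k _; rewrite (L2dotC Om f).
  rewrite dP//; apply: (@cvg_trans _ ((\sum_(k < N) dot psi (phi k) * dot (v d) (phi k)) @[d --> F])).
    by apply: near_eq_cvg; apply: filterS vB => d [Lv _]; rewrite dP.
  apply: (@cvg_sum_ord _ _ F FF N (fun k d => dot psi (phi k) * dot (v d) (phi k))
    (fun k => dot psi (phi k) * dot u (phi k))) => k.
  by apply: cvgMr; exact: vu.
have e20 : 0 < e / 2 by rewrite divr_gt0.
move/cvgrPdist_lt : cP => /(_ _ e20); apply: filterS2 vB => d [Lv vBd] h.
have LD := L2_sub LP Lpsi.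
have split f : L2 Om f -> dot f psi = dot f P - dot f (P \- psi).
  by move=> Lf; rewrite (L2dotC Om f P) (L2dotC Om f (P \- psi)) L2dotBl// subKr L2dotC.
rewrite (split u)// (split (v d))//.
have h1 : `|dot u (P \- psi)| <= nrm u * nrm (P \- psi) by exact: L2dot_CauchySchwarz.
have h2 : `|dot (v d) (P \- psi)| <= `|B| * nrm (P \- psi).
  apply: le_trans (L2dot_CauchySchwarz Lv LD) _.
  by rewrite ler_wpM2r ?L2norm_ge0// (le_trans vBd)// ler_norm.
have h3 : (`|B| + nrm u) * nrm (P \- psi) < e / 2.
  apply: le_lt_trans (_ : (`|B| + nrm u + 1) * nrm (P \- psi) < _).
    by rewrite ler_wpM2r ?L2norm_ge0// lerDl.
  by rewrite mulrC -ltr_pdivlMr.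
set x := dot u _ in h *; set y := dot (v d) P in h *.
move: h1 h2 h3; set z := dot u _; set w := dot (v d) _; set r := nrm (P \- psi).
move=> h1 h2 h3.
have -> : x - z - (y - w) = (x - y) + (w - z) by ring.
apply: le_lt_trans (ler_normD _ _) _.
apply: le_lt_trans (lerD (lexx _) (ler_normB _ _)) _.
by move: h h1 h2 h3; rewrite mulrDl; lra.
Qed.

End weak_convergence.

Section landweber_coefficients.
Context (R : realType) (n : nat) (Om : domain R n).
Variables (lam : nat -> R) (phi : nat -> 'rV[R]_n -> R).
Local Notation dot := (L2dot Om).
Local Notation nrm := (L2norm Om).
Hypothesis phiL2 : forall k, L2 Om (phi k).
Hypothesis phi_ortho : forall i j, dot (phi i) (phi j) = (i == j)%:R.
Hypothesis phi_basis : forall f, L2 Om f ->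
  nrm ((fun x => \sum_(k < N) dot f (phi k) * phi k x) \- f) @[N --> \oo] --> 0.
Hypothesis lam0_gt0 : 0 < lam 0%N.
Hypothesis lam_ge : forall k, lam 0%N <= lam k.

Lemma L2_spectral m f : L2 Om f -> L2 Om (spectral Om lam phi m f).
Proof. by move=> Lf; case: (spectral_spec phiL2 phi_ortho lam m Lf). Qed.

Lemma coef_opp_power (s : R) f k : 0 <= s -> L2 Om f ->
  dot (opp_power Om lam phi (- (2 * s)) f) (phi k) = lam k `^ (- (2 * s)) * dot f (phi k).
Proof.
move=> s0 Lf; apply: (@coef_spectral _ _ _ _ phiL2 phi_ortho lam (fun l => l `^ (- (2 * s)))
  (lam 0%N `^ (- (2 * s)))) => // j.
rewrite ger0_norm ?powR_ge0// !powRN lef_pV2 ?posrE ?powR_gt0//; last first.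
  exact: lt_le_trans (lam_ge j).
apply: ge0_ler_powR; rewrite ?nnegrE ?mulr_ge0 ?(ltW lam0_gt0)//.
exact: le_trans (ltW lam0_gt0) (lam_ge j).
Qed.

Lemma coef_semigroup T f k : 0 <= T -> L2 Om f ->
  dot (semigroup Om lam phi T f) (phi k) = expR (- (lam k * T)) * dot f (phi k).
Proof.
move=> T0 Lf; apply: (@coef_spectral _ _ _ _ phiL2 phi_ortho lam
  (fun l => expR (- (l * T))) 1) => // j.
rewrite ger0_norm ?expR_ge0// -expR0 ler_expR oppr_le0 mulr_ge0//.
exact: le_trans (ltW lam0_gt0) (lam_ge j).
Qed.

Lemma L2_landweber (mu s : R) f i : L2 Om f -> L2 Om (landweber Om lam phi mu s f i).
Proof.
move=> Lf; elim: i => [|i IH]; first exact: L2_cst0.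
apply: L2_sub => //; apply: L2_scale; apply: L2_spectral; exact: L2_sub.
Qed.

Lemma coef_landweber (mu s : R) f i k : 0 <= s -> L2 Om f ->
  dot (landweber Om lam phi mu s f i) (phi k) =
  landweber_factor (mu * lam k `^ (- (2 * s))) i * dot f (phi k).
Proof.
move=> s0 Lf; elim: i => [|i IH].
  by rewrite /= L2dot0l /landweber_factor expr0 subrr mul0r.
have Lw := L2_landweber mu s i Lf.
have Lo : L2 Om (opp_power Om lam phi (- (2 * s)) (landweber Om lam phi mu s f i \- f)).
  by apply: L2_spectral; exact: L2_sub.
rewrite /= L2dotBl//; last exact: L2_scale.
rewrite [X in _ - X](L2dotZl mu Lo (phiL2 k)) coef_opp_power//; last exact: L2_sub.
rewrite L2dotBl// IH /landweber_factor exprS; ring.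
Qed.

(** Test the operator bound on the eigenfunction itself. *)
Lemma landweber_step_le1 (mu s : R) k : 0 <= s ->
  nrm (mu \*: opp_power Om lam phi (- (2 * s)) (phi k)) <= nrm (phi k) ->
  mu * lam k `^ (- (2 * s)) <= 1.
Proof.
move=> s0 H.
have nk : nrm (phi k) = 1.
  apply/eqP; rewrite -(@eqrXn2 _ 2)// ?L2norm_ge0// L2norm_sqr phi_ortho eqxx.
  by rewrite expr1n.
have Lo : L2 Om (opp_power Om lam phi (- (2 * s)) (phi k)) by exact: L2_spectral.
have := coef_norm_le phiL2 phi_ortho k (L2_scale mu Lo).
rewrite L2dotZl// coef_opp_power// phi_ortho eqxx mulr1 => h.
apply: le_trans (ler_norm _) _; apply: le_trans h _.
by rewrite -[leRHS]nk.
Qed.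

End landweber_coefficients.

(** * A priori bound from the discrepancy principle *)

Section discrepancy_principle.
Context (R : realType) (n : nat) (Om : domain R n) (phi : nat -> 'rV[R]_n -> R).
Local Notation dot := (L2dot Om).
Local Notation nrm := (L2norm Om).
Hypothesis phiL2 : forall k, L2 Om (phi k).
Hypothesis phi_ortho : forall i j, dot (phi i) (phi j) = (i == j)%:R.
Hypothesis phi_basis : forall f, L2 Om f ->
  nrm ((fun x => \sum_(k < N) dot f (phi k) * phi k x) \- f) @[N --> \oo] --> 0.

Lemma norm_sqr_le_coef f (K a b A B : R) (U V : nat -> R) : L2 Om f ->
  (forall k, `|dot f (phi k)| <= K * (a * U k + b * V k)) ->
  (forall N, \sum_(k < N) U k ^+ 2 <= A) -> (forall N, \sum_(k < N) V k ^+ 2 <= B) ->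
  nrm f ^+ 2 <= 2 * K ^+ 2 * (a ^+ 2 * A + b ^+ 2 * B).
Proof.
move=> Lf fK UA VB; apply: parseval_le => // N.
apply: (@le_trans _ _ (2 * K ^+ 2 * (a ^+ 2 * \sum_(k < N) U k ^+ 2 +
    b ^+ 2 * \sum_(k < N) V k ^+ 2))); last first.
  apply: ler_wpM2l; first by rewrite mulr_ge0 ?sqr_ge0.
  by apply: lerD; apply: ler_wpM2l => //; exact: sqr_ge0.
rewrite !mulr_sumr -big_split mulr_sumr; apply: ler_sum => k _ /=.
rewrite -(real_normK (num_real (dot f _))).
apply: (@le_trans _ _ ((K * (a * U k + b * V k)) ^+ 2)).
  by rewrite lerXn2r ?nnegrE// (le_trans _ (fK k)).
rewrite exprMn (mulrC 2) -[leRHS]mulrA; apply: ler_wpM2l; first exact: sqr_ge0.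
by rewrite -!exprMn; set x := a * _; set y := b * _; have := sqr_ge0 (x - y); nra.
Qed.

(* The lower discrepancy bound forces [td] to be [O(eps)], which tames the
   factor [eps^-1] in front of the noise. *)
Lemma discrepancy_norm_le v r (K M eps td dl W : R) (U eta : nat -> R) :
  L2 Om v -> L2 Om r -> 0 < eps -> 0 <= td ->
  (forall k, `|dot v (phi k)| <= K * (U k + M / eps * `|eta k|)) ->
  (forall k, `|dot r (phi k)| <= K * (eps * U k + M * `|eta k|)) ->
  (forall N, \sum_(k < N) U k ^+ 2 <= W) ->
  (forall N, \sum_(k < N) eta k ^+ 2 <= dl ^+ 2) ->
  4 * K ^+ 2 * (M ^+ 2 * dl ^+ 2) <= td ^+ 2 -> td <= nrm r ->
  nrm v ^+ 2 <= 4 * K ^+ 2 * W.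
Proof.
move=> Lv Lr eps0 td0 hv hr hU heta hM htd.
have heta' N : \sum_(k < N) `|eta k| ^+ 2 <= dl ^+ 2.
  by under eq_bigr do rewrite real_normK ?num_real//.
have hv' k : `|dot v (phi k)| <= K * (1 * U k + M / eps * `|eta k|) by rewrite mul1r.
have h1 := norm_sqr_le_coef Lv hv' hU heta'.
have h2 := norm_sqr_le_coef Lr hr hU heta'.
have h3 : td ^+ 2 <= nrm r ^+ 2 by rewrite lerXn2r ?nnegrE ?L2norm_ge0.
have e2 : 0 < eps ^+ 2 by rewrite exprn_gt0.
(* The noise part of the bound on the residual is at most half of td ^ 2, hence at most the part
   with eps ^ 2 W. *)
have h4 : M ^+ 2 * dl ^+ 2 * K ^+ 2 <= K ^+ 2 * (eps ^+ 2 * W).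
  move: h2 h3 hM; move: (M ^+ 2 * _) => P; move: (eps ^+ 2 * W) => Q.
  move: (nrm r ^+ 2) (K ^+ 2) (td ^+ 2) => a b c; lra.
apply: le_trans h1 _; rewrite expr1n mul1r.
have -> : 4 * K ^+ 2 * W = 2 * K ^+ 2 * W + 2 * (K ^+ 2 * W) by ring.
rewrite mulrDr lerD2l expr_div_n.
have -> : 2 * K ^+ 2 * (M ^+ 2 / eps ^+ 2 * dl ^+ 2) =
    2 * (M ^+ 2 * dl ^+ 2 * K ^+ 2 / eps ^+ 2) by ring.
rewrite ler_wpM2l// ler_pdivrMr//; apply: le_trans h4 _.
by rewrite le_eqVlt; apply/orP; left; apply/eqP; ring.
Qed.

End discrepancy_principle.

Section noise_levels.
Variable R : realType.

(** Since ln (U / d) <= U / d, the square of the left-hand side is at most c ^ 2 U d. *)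
Lemma near0_log_noise_le (c U b : R) : 0 <= c -> 0 < U -> 0 < b ->
  \forall d \near 0^'+, c * d * Num.sqrt (ln (U / d)) <= b.
Proof.
move=> c0 U0 b0; have k0 : 0 < b ^+ 2 / (c ^+ 2 * U + 1).
  by rewrite divr_gt0 ?exprn_gt0// ltr_wpDl// mulr_ge0 ?sqr_ge0// ltW.
near=> d.
have d0 : 0 < d by near: d; exact: nbhs_right_gt.
have db : d <= b ^+ 2 / (c ^+ 2 * U + 1) by near: d; exact: nbhs_right_le.
have L0 : 0 <= ln (U / d) by near: d; exact: near0_ln_ge.
have Ud : 0 < U / d by rewrite divr_gt0.
rewrite -(@ler_pXn2r _ 2)// ?nnegrE ?mulr_ge0 ?sqrtr_ge0 ?(ltW d0) ?(ltW b0)//.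
rewrite exprMn sqr_sqrtr//.
apply: (@le_trans _ _ ((c * d) ^+ 2 * (U / d))).
  rewrite ler_wpM2l ?sqr_ge0//; apply: le_trans (ln_le_subr1 Ud) _.
  by rewrite gerBl.
have -> : (c * d) ^+ 2 * (U / d) = c ^+ 2 * U * d by field; rewrite gt_eqF.
have D0 : 0 < c ^+ 2 * U + 1 by rewrite ltr_wpDl// mulr_ge0 ?sqr_ge0// ltW.
move: db; rewrite ler_pdivlMr// => h; apply: le_trans h.
by rewrite mulrC ler_wpM2l ?(ltW d0)// lerDl.
Unshelve. all: by end_near. Qed.

End noise_levels.

Theorem theorem6p3 (R : realType) (n : nat) (n_gt0 : (0 < n)%N)
  (Om : domain R n) (L : diff_op R n)
  (lam : nat -> R) (phi : nat -> 'rV[R]_n -> R)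
  (L_elliptic : elliptic_operator Om L)
  (L_eigen : eigen_system Om L lam phi)
  (T : R) (T_gt0 : 0 < T)
  (p : R) (p_gt1 : 1 < p)
  (u0 : 'rV[R]_n -> R)
  (u0_dotH : dotH Om lam phi (2 * (1 + 2 / p)) u0)
  (u0_neq0 : L2norm Om u0 != 0)
  (s : R) (s_ge : 1 + 1 / p <= s)
  (mu : R) (mu_gt0 : 0 < mu)
  (mu_le : forall f, L2 Om f ->
     L2norm Om (mu \*: opp_power Om lam phi (- (2 * s)) f) <= L2norm Om f)
  (gd : R -> 'rV[R]_n -> R)
  (gd_near : \forall d \near 0^'+,
     L2 Om (gd d) /\ L2norm Om (semigroup Om lam phi T u0 \- gd d) <= d)
  (istar : R -> nat)
  (istar_near : comparable_near0 (fun d => (istar d)%:R)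
     (fun d => T ^- 2 * ln (L2norm Om u0 / d)))
  (C2 : R) (C2_gt0 : 0 < C2)
  (tau1 tau2 : R) (tau1_gt1 : 1 < tau1) (tau12 : tau1 < tau2)
  (alpha : R -> R) :
  let tgd d := landweber Om lam phi mu s (gd d) (istar d) in
  let u0d d a := frac_backward Om lam phi T a (tgd d) in
  let td d := C2 * T^-1 * d * Num.sqrt (ln (L2norm Om u0 / d)) in
  (\forall d \near 0^'+, 0 < alpha d < 1 /\
     tau1 * td d
       <= L2norm Om (semigroup Om lam phi T (u0d d (alpha d)) \- tgd d)
       <= tau2 * td d) ->
  weakly_cvg Om 0^'+ (fun d => u0d d (alpha d)) u0.

Proof.
move=> tgd u0d td Hdisc.
case: L_eigen => lam0 lam_homo graph ortho basis.
have phiL2 k : L2 Om (phi k) by case: (graph k) => -[].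
have lam_ge k : lam 0%N <= lam k by exact: lam_homo.
have lam_gt0 k : 0 < lam k := lt_le_trans lam0 (lam_ge k).
have Lu0 : L2 Om u0 by case: u0_dotH.
have p0 : 0 < p by rewrite (lt_trans _ p_gt1).
(* Half of 1 / p: then s >= 1 + 2 q leaves room above 1 + q, and the smoothness exponent 1 + 2 / p
   of [u0] becomes 1 + 4 q. *)
pose q : R := (2 * p)^-1.
have q0 : 0 < q by rewrite invr_gt0 mulr_gt0.
have q12 : q < 2^-1 by rewrite ltf_pV2 ?posrE ?mulr_gt0// ltr_pMr.
have q1 : 0 < q < 1 by rewrite q0; lra.
have p2q : 1 / p = 2 * q by rewrite /q; field; rewrite gt_eqF.
have p4q : 2 / p = 4 * q by rewrite /q; field; rewrite gt_eqF.
have s_ge' : 1 + 2 * q <= s by rewrite -p2q.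
have s0 : 0 < s by lra.
(* Solves 2 s th = 1 + q, so that the filter bound (i x) ^ th exactly cancels l ^ (1 + q). *)
pose th : R := (1 + q) / (2 * s).
have th0 : 0 < th by rewrite divr_gt0; lra.
have th12 : th * 2 < 1 by rewrite /th mulrAC ltr_pdivrMr; lra.
have U0gt : 0 < L2norm Om u0 by rewrite lt0r u0_neq0 L2norm_ge0.
set Un := L2norm Om u0 in U0gt *.
pose u k := L2dot Om u0 (phi k).
pose ex k := expR (- (lam k * T)).
have ex01 k : 0 < ex k <= 1.
  by rewrite expR_gt0 -expR0 ler_expR oppr_le0 mulr_ge0// ltW.
pose x k := mu * lam k `^ (- (2 * s)).
have x0 k : 0 < x k by rewrite mulr_gt0// powR_gt0.
have x01 k : 0 <= x k <= 1.
  rewrite (ltW (x0 k)) /=.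
  apply: (landweber_step_le1 phiL2 ortho lam0 lam_ge (ltW s0)).
  exact: (mu_le _ (phiL2 k)).
have [CA CA0 HA] := mittag_leffler_inv_le lam0 T_gt0.
have [CE CE0 HE] := mittag_leffler_expR lam0 T_gt0 q1.
have [K K0 HK] := backward_coef_bounds lam0 q0 CA0 CE0.
pose U k := lam k `^ (1 + 4 * q) * `|u k|.
have [W HW] : exists W, forall N, \sum_(k < N) U k ^+ 2 <= W.
  case: u0_dotH => _; set S := (\sum_(k <oo) _)%E => Sy.
  have t0 k : 0 <= lam k `^ (2 * (1 + 2 / p)) * u k ^+ 2.
    by rewrite mulr_ge0 ?powR_ge0 ?sqr_ge0.
  have SN N : (\sum_(0 <= k < N) (lam k `^ (2 * (1 + 2 / p)) * u k ^+ 2)%:E <= S)%E.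
    by apply: nneseries_lim_ge => k _ _; rewrite lee_fin.
  have S0 : (0 <= S)%E by have := SN 0%N; rewrite big_geq.
  exists (fine S) => N; rewrite -lee_fin fineK ?ge0_fin_numE//.
  apply: le_trans (SN N); rewrite sumEFin lee_fin big_mkord.
  apply: ler_sum => k _; rewrite /U exprMn real_normK ?num_real//.
  by rewrite p4q (mulrC 2) powRrM powR_mulrn ?powR_ge0.
have [c [Cc [c0 cC Hist]]] := istar_near.
have Cc0 : 0 < Cc := lt_le_trans c0 cC.
have T2 : 0 < T ^- 2 by rewrite invr_gt0 exprn_gt0.
have c20 : 0 < (C2 * T^-1) ^+ 2 by rewrite exprn_gt0// mulr_gt0// invr_gt0.
have A0 : 0 < Cc * T ^- 2 * mu by rewrite !mulr_gt0.
have K20 : 0 < 4 * K ^+ 2 by rewrite mulr_gt0// exprn_gt0.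
(* Beyond this threshold for the logarithm, the stopping rule makes 4 K ^ 2 M ^ 2 d ^ 2 at most td ^
   2. *)
have [L0 HL0] := near0_ln_absorb A0 K20 c20 th12.
pose g := semigroup Om lam phi T u0.
have Lg : L2 Om g by exact: (@L2_spectral _ _ _ lam phi phiL2 ortho).
have gk k : L2dot Om g (phi k) = ex k * u k.
  exact: (coef_semigroup phiL2 ortho lam0 lam_ge _ (ltW T_gt0) Lu0).
pose v d := u0d d (alpha d).
pose r d := semigroup Om lam phi T (v d) \- tgd d.
pose eta d k := L2dot Om (gd d) (phi k) - ex k * u k.
have stage : \forall d \near 0^'+, [/\ L2 Om (v d), L2norm Om (v d) ^+ 2 <= 4 * K ^+ 2 * W &
    forall k, ex k * `|L2dot Om (v d) (phi k) - u k| <=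
      tau2 * td d + (1 - landweber_factor (x k) (istar d)) * `|u k| + d].
  near=> d.
  have d0 : 0 < d by near: d; exact: nbhs_right_gt.
  have [Lgd gdd] : L2 Om (gd d) /\ L2norm Om (g \- gd d) <= d by near: d.
  have /andP[id1 id2] : c * (T ^- 2 * ln (Un / d)) <= (istar d)%:R <=
      Cc * (T ^- 2 * ln (Un / d)) by near: d.
  have [/andP[a0 a1] /andP[D1 D2]] : 0 < alpha d < 1 /\ tau1 * td d
       <= L2norm Om (semigroup Om lam phi T (u0d d (alpha d)) \- tgd d)
       <= tau2 * td d by near: d.
  have L1 : 1 <= ln (Un / d) by near: d; exact: near0_ln_ge.
  have L2' : L0 <= ln (Un / d) by near: d; exact: near0_ln_ge.
  set Ld := ln (Un / d) in id1 id2 L1 L2'.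
  have Lpos : 0 < Ld by rewrite (lt_le_trans _ L1).
  have Ltg : L2 Om (tgd d) by exact: (@L2_landweber _ _ _ lam phi phiL2 ortho).
  have [Lv Hv] := spectral_spec phiL2 ortho lam
    (fun l => (mittag_leffler (alpha d) (- (l * T `^ alpha d)))^-1) Ltg.
  have {}Lv : L2 Om (v d) by exact: Lv.
  have Ls : L2 Om (semigroup Om lam phi T (v d)) by exact: (@L2_spectral _ _ _ lam phi phiL2 ortho).
  have Lr : L2 Om (r d) by exact: L2_sub.
  have tk k : L2dot Om (tgd d) (phi k) =
      landweber_factor (x k) (istar d) * (ex k * u k + eta d k).
    rewrite (coef_landweber phiL2 ortho lam0 lam_ge mu _ k (ltW s0) Lgd).
    by rewrite /eta addrC subrK.
  have sk k : L2dot Om (semigroup Om lam phi T (v d)) (phi k) = ex k * L2dot Om (v d) (phi k).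
    exact: (coef_semigroup phiL2 ortho lam0 lam_ge _ (ltW T_gt0) Lv).
  have rk k : L2dot Om (r d) (phi k) =
      ex k * L2dot Om (v d) (phi k) - L2dot Om (tgd d) (phi k).
    by rewrite /r L2dotBl// sk.
  have etak k : L2dot Om (g \- gd d) (phi k) = - eta d k.
    by rewrite L2dotBl// gk /eta opprB.
  have td0 : 0 <= td d.
    by rewrite /td !mulr_ge0 ?sqrtr_ge0 ?invr_ge0// ltW.
  have td2 : td d ^+ 2 = (C2 * T^-1) ^+ 2 * Ld * d ^+ 2.
    have -> : td d = C2 * T^-1 * d * Num.sqrt Ld by [].
    by rewrite exprMn sqr_sqrtr ?(ltW Lpos)//; ring.
  have etaN N : \sum_(k < N) eta d k ^+ 2 <= d ^+ 2.
    apply: (@le_trans _ _ (L2norm Om (g \- gd d) ^+ 2)).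
      have := bessel phiL2 ortho N (L2_sub Lg Lgd).
      by under eq_bigr do rewrite etak sqrrN.
    by rewrite lerXn2r ?nnegrE ?L2norm_ge0// ltW.
  have eta_le k : `|eta d k| <= d.
    rewrite -normrN -etak; apply: le_trans gdd.
    exact: (coef_norm_le phiL2 ortho k (L2_sub Lg Lgd)).
  split => //.
    (* If the series of the regularized solution diverges, [v d] is 0 by default and the norm bound
       is trivial. *)
    case: Hv => [Hv|v0]; last first.
      rewrite (_ : v d = cst 0) ?L2norm_sqr ?L2dot0l//.
      by rewrite mulr_ge0 ?(ltW K20)// (le_trans _ (HW 0%N))// big_ord0.
    pose M := ((istar d)%:R * mu) `^ th.
    have HB k := HK (lam k) (1 - alpha d)
      (mittag_leffler (alpha d) (- (lam k * T `^ alpha d))) (ex k)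
      (landweber_factor (x k) (istar d)) M (u k) (eta d k).
    have rhoM k : landweber_factor (x k) (istar d) * lam k `^ (1 + q) <= M.
      apply: (@le_trans _ _ (((istar d)%:R * x k) `^ th * lam k `^ (1 + q))).
        rewrite ler_wpM2r ?powR_ge0// landweber_factor_le_powR//.
        by rewrite (ltW th0); lra.
      rewrite /x mulrA powRM ?mulr_ge0 ?powR_ge0 ?(ltW mu_gt0)// -powRrM.
      have -> : - (2 * s) * th = - (1 + q) by rewrite /th; field; rewrite gt_eqF.
      by rewrite -mulrA powRN mulVf ?mulr1 ?gt_eqF ?powR_gt0.
    have a1' : 0 < 1 - alpha d by rewrite subr_gt0.
    have a01 : 0 < alpha d < 1 by rewrite a0.
    have {}HB k := HB k (lam_ge k) a1' (mittag_leffler_gt0 a01 (lam_gt0 k) T_gt0)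
      (ex01 k) (introT andP (conj (landweber_factor_ge0 (istar d) (x01 k))
        (landweber_factor_le1 (istar d) (x01 k)))) (HA _ _ a01 (lam_ge k))
      (HE _ _ a01 (lam_ge k)) (rhoM k).
    apply: (discrepancy_norm_le phiL2 ortho basis (r := r d) (M := M) (eps := 1 - alpha d)
      (td := td d) (dl := d) (U := U) (eta := eta d)) => //.
    - by move=> k; rewrite Hv tk; case: (HB k).
    - by move=> k; rewrite rk Hv tk; case: (HB k).
    - rewrite td2 mulrA ler_wpM2r ?sqr_ge0//; apply: le_trans (HL0 Ld L2' Lpos).
      rewrite ler_wpM2l ?(ltW K20)// powRrM powR_mulrn ?powR_ge0//.
      rewrite lerXn2r ?nnegrE ?powR_ge0//.
      apply: ge0_ler_powR; first exact: ltW.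
      - by rewrite nnegrE (mulr_ge0 (ler0n _ _) (ltW mu_gt0)).
      - by rewrite nnegrE (mulr_ge0 (ltW A0) (ltW Lpos)).
      rewrite [leRHS]mulrAC ler_wpM2r ?(ltW mu_gt0)//.
      by rewrite -[leRHS]mulrA.
    - by apply: le_trans D1; rewrite ler_peMl// ltW.
  move=> k; have /andP[ek0 ek1] := ex01 k.
  have f0 := landweber_factor_ge0 (istar d) (x01 k).
  have f1 := landweber_factor_le1 (istar d) (x01 k).
  set rho := landweber_factor _ _ in tk f0 f1 *.
  rewrite -{1}(gtr0_norm ek0) -normrM mulrBr.
  (* The error, damped by [ex k], in terms of the residual, the smoothing error of the filter and
     the filtered noise; no bound depending on [alpha] enters. *)
  have -> : ex k * L2dot Om (v d) (phi k) - ex k * u k =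
      L2dot Om (r d) (phi k) - (1 - rho) * (ex k * u k) + rho * eta d k.
    by rewrite rk tk -/rho; ring.
  apply: le_trans (ler_normD _ _) _; apply: lerD; last first.
    rewrite normrM (ger0_norm f0); apply: le_trans (eta_le k).
    by rewrite ler_piMl.
  apply: le_trans (ler_normB _ _) _; apply: lerD.
    by apply: le_trans D2; exact: (coef_norm_le phiL2 ortho k Lr).
  rewrite !normrM ger0_norm ?subr_ge0// (gtr0_norm ek0).
  by rewrite ler_wpM2l ?subr_ge0// ler_piMl.
apply: (@weakly_cvg_coef _ _ _ phi phiL2 basis _ _ v u0 (1 + 4 * K ^+ 2 * W)) => //.
  apply: filterS stage => d [Lv nv _]; split => //.
  (* The bound on the squared norm gives one on the norm by 2 t <= 1 + t ^ 2, whence the constant 1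
     + 4 K ^ 2 W. *)
  by have := sqr_ge0 (L2norm Om (v d) - 1); move: nv; rewrite expr2; nra.
move=> k; apply/cvgrPdist_le => e e0; have /andP[ek0 ek1] := ex01 k.
(* One share for each of the three terms of [stage]; dividing by [ex k] is possible because k is
   fixed. *)
pose e1 := e * ex k / 3.
have e10 : 0 < e1 by rewrite divr_gt0// mulr_gt0.
have t20 : 0 < tau2 by rewrite (lt_trans _ tau12)// (lt_trans _ tau1_gt1).
have b0 : 0 < e1 / tau2 by rewrite divr_gt0.
have cT0 : 0 <= C2 * T^-1 by rewrite mulr_ge0 ?invr_ge0 ?(ltW C2_gt0) ?(ltW T_gt0).
near=> d.
have [_ _ /(_ k) Hk] : [/\ L2 Om (v d), L2norm Om (v d) ^+ 2 <= 4 * K ^+ 2 * W &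
    forall k, ex k * `|L2dot Om (v d) (phi k) - u k| <=
      tau2 * td d + (1 - landweber_factor (x k) (istar d)) * `|u k| + d] by near: d.
have h1 : td d <= e1 / tau2 by near: d; exact: near0_log_noise_le.
have h2 : d <= e1 by near: d; exact: nbhs_right_le.
have /andP[id1 _] : c * (T ^- 2 * ln (Un / d)) <= (istar d)%:R <=
    Cc * (T ^- 2 * ln (Un / d)) by near: d.
(* Makes i large enough that |u k| <= e1 i x, as [landweber_defect_le] requires to bring the
   smoothing error below e1. *)
have h3 : `|u k| / e1 / (c * T ^- 2 * x k) <= ln (Un / d) by near: d; exact: near0_ln_ge.
have f1 := landweber_factor_le1 (istar d) (x01 k).
have h4 : (1 - landweber_factor (x k) (istar d)) * `|u k| <= e1.
  have D := landweber_defect_le (istar d) (x01 k).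
  have ux : `|u k| / e1 <= (istar d)%:R * x k.
    apply: (@le_trans _ _ (c * (T ^- 2 * ln (Un / d)) * x k)); last first.
      by rewrite ler_wpM2r// ltW.
    move: h3; rewrite ler_pdivrMr ?(mulr_gt0 (mulr_gt0 c0 T2) (x0 k))// => h3; apply: le_trans h3 _.
    by rewrite le_eqVlt; apply/orP; left; apply/eqP; ring.
  have ux' : `|u k| <= e1 * ((istar d)%:R * x k) by move: ux; rewrite ler_pdivrMr// mulrC.
  apply: (@le_trans _ _ (e1 * ((1 - landweber_factor (x k) (istar d)) * (1 + (istar d)%:R * x k)))).
    rewrite (mulrCA e1) ler_wpM2l ?subr_ge0//; apply: le_trans ux' _.
    by rewrite ler_wpM2l ?(ltW e10)// lerDr.
  by rewrite -[leRHS]mulr1 ler_wpM2l ?(ltW e10).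
have h1' : tau2 * td d <= e1 by rewrite mulrC -ler_pdivlMr.
rewrite distrC -(@ler_pM2l _ (ex k))//; apply: le_trans Hk _.
have -> : ex k * e = e1 + e1 + e1 by rewrite /e1; field.
by rewrite lerD// lerD.
Unshelve. all: by end_near. Qed.
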